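(* Let $\kappa$ be an arbitrary real constant and $\lambda$ an arbitrary positive constant. Then the stochastic differential equation $$\mathrm{d}X(t)=\kappa\,\mathbf{1}_{\{X(t)>0\}}\,\mathrm{d}t+\lambda\,\mathbf{1}_{\{X(t)\le 0\}}\,\mathrm{d}t+\mathbf{1}_{\{X(t)>0\}}\,\mathrm{d}W(t),\qquad 0\le t<\infty,$$ has no weak solution which satisfies $$\int_0^T\mathbf{1}_{\{X(t)=0\}}\,\mathrm{d}t=0\quad\text{almost surely, for all } T\in[0,\infty).$$ In particular, this is the case for $\kappa=\lambda>0$, i.e., the equation $\mathrm{d}X(t)=\lambda\,\mathrm{d}t+\mathbf{1}_{\{X(t)>0\}}\,\mathrm{d}W(t)$, $0\le t<\infty$, has no weak solution satisfying this condition.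
   Context: A weak solution consists of some filtered probability space together with a continuous adapted real-valued process $X$ (with some initial distribution) and a standard one-dimensional Brownian motion $W$ relative to the filtration of that space, such that, with probability one, the integrated form of the equation, $$X(t)=X(0)+\int_0^t\big(\kappa\,\mathbf{1}_{\{X(s)>0\}}+\lambda\,\mathbf{1}_{\{X(s)\le0\}}\big)\,\mathrm{d}s+\int_0^t\mathbf{1}_{\{X(s)>0\}}\,\mathrm{d}W(s),$$ holds for all $t\ge 0$. *)

(* Defs.v *)
From HB Require Import structures.
From mathcomp Require Import all_boot all_order all_algebra.
From mathcomp Require Import all_classical all_reals all_analysis.

Set Implicit Arguments.
Unset Strict Implicit.
Unset Printing Implicit Defensive.

Import Order.TTheory GRing.Theory Num.Theory.
Import numFieldNormedType.Exports.

Local Open Scope classical_set_scope.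
Local Open Scope ring_scope.

(* Time is the half-line [0, +oo[ of R.  Processes and filtrations are indexed
   by all of R, but nothing is ever required of them at negative times. *)

Section Filtered.
Context d (T : measurableType d) (R : realType).
Implicit Types (F : R -> set (set T)) (X W M H : R -> T -> R).

Definition filtration F : Prop :=
  (forall t : R, 0 <= t -> sigma_algebra setT (F t) /\ F t `<=` measurable) /\
  (forall s t : R, 0 <= s -> s <= t -> F s `<=` F t).

Definition measurable_wrt (G : set (set T)) (xi : T -> R) : Prop :=
  forall B : set R, measurable B -> G (xi @^-1` B).

Definition adapted F X : Prop := forall t : R, 0 <= t -> measurable_wrt (F t) (X t).

Definition continuous_process X : Prop :=
  forall w, {within `[0, +oo[, continuous (fun t => X t w)}.

Definition independent_of (P : probability T R) (G : set (set T))
    (xi : T -> R) : Prop :=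
  forall (A : set T) (B : set R), G A -> measurable B ->
    P (A `&` xi @^-1` B) = (P A * P (xi @^-1` B))%E.

(* The second parameter of normal_prob is the standard deviation. *)
Definition brownian_motion (P : probability T R) F W : Prop :=
  [/\ continuous_process W, adapted F W,
      {ae P, forall w, W 0 w = 0},
      (forall s t : R, 0 <= s -> s < t ->
         independent_of P (F s) (fun w => W t w - W s w)) &
      (forall s t : R, 0 <= s -> s < t -> forall B : set R, measurable B ->
         P ((fun w => W t w - W s w) @^-1` B) =
         normal_prob 0 (Num.sqrt (t - s)) B)].

(* H(t) = \sum_(i < n) xi_i 1_{]t_i, t_{i+1}]}(t), with xi_i bounded and
   measurable with respect to F(t_i). *)
Record simple_process F : Type := SimpleProcess {
  sp_size : nat;
  sp_time : nat -> R;
  sp_coef : nat -> T -> R;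
  sp_time_ge0 : 0 <= sp_time 0%N;
  sp_time_le : forall i j, (i <= j)%N -> sp_time i <= sp_time j;
  sp_coef_bounded :
    exists C : R, forall i w, (i < sp_size)%N -> `|sp_coef i w| <= C;
  sp_coef_measurable :
    forall i, (i < sp_size)%N -> measurable_wrt (F (sp_time i)) (sp_coef i)
}.

Definition simple_eval F (S : simple_process F) (t : R) (w : T) : R :=
  \sum_(i < sp_size S)
    sp_coef S i w * \1_(`]sp_time S i, sp_time S i.+1]%classic) t.

Definition simple_integral F (S : simple_process F) W (t : R) (w : T) : R :=
  \sum_(i < sp_size S) sp_coef S i w *
    (W (Num.min (sp_time S i.+1) t) w - W (Num.min (sp_time S i) t) w).

(* M is (a continuous version of) the Ito integral of H with respect to W: the
   L^2 limit of the integrals of simple processes that approximate H in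
   L^2([0, t] x T) for every t.  This is the classical L^2 theory, which covers
   all bounded progressively measurable H.  M t is then automatically
   measurable for the P-completion of F t. *)
Definition ito_integral (P : probability T R) F W H M : Prop :=
  [/\ continuous_process M,
      (forall t : R, 0 <= t -> measurable_fun setT (M t)) &
      exists S : nat -> simple_process F, forall t : R, 0 <= t ->
        (fun n => \int[P]_w \int[lebesgue_measure]_(s in `[0%R, t])
           ((simple_eval (S n) s w - H s w) ^+ 2)%R%:E)%E @ \oo --> 0%E /\
        (fun n => \int[P]_w
           ((simple_integral (S n) W t w - M t w) ^+ 2)%R%:E)%E @ \oo --> 0%E].

(* dX(t) = b(X(t)) dt + sigma(X(t)) dW(t), for bounded Borel b and sigma;
   the initial law is arbitrary. *)
Definition weak_solution (b sigma : R -> R) (P : probability T R) F X W : Prop :=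
  [/\ filtration F, brownian_motion P F W,
      continuous_process X, adapted F X &
      exists2 M, ito_integral P F W (fun t w => sigma (X t w)) M &
        {ae P, forall w, forall t : R, 0 <= t ->
           X t w = X 0 w
             + \int[lebesgue_measure]_(s in `[0, t]) b (X s w) + M t w}].

Definition no_time_at_zero (P : probability T R) X : Prop :=
  forall t : R, 0 <= t ->
    {ae P, forall w, \int[lebesgue_measure]_(s in `[0, t])
                       \1_[set 0 : R] (X s w) = 0}.

End Filtered.

(* Main.v *)
(** While [X < 0] the noise is switched off, so [X] moves with slope [lambda > 0];
    hence once nonnegative, [X] stays nonnegative, and from [X 0 >= - lambda k] it
    is nonnegative after time [k].  Spending no time at zero, it then satisfies
    [dX = kappa dt + dW] on [[k, k+1]], and a Brownian increment independent of
    the past is unbounded below: a contradiction.  Both uses of the locality of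
    the Ito integral come from one [L^2] bound ([ito_localization_bound]), which is
    the isometry for simple processes cut off by past events along a time grid. *)

Require Import Defs.
From HB Require Import structures.
From mathcomp Require Import all_boot all_order all_algebra.
From mathcomp Require Import all_classical all_reals all_analysis.
From mathcomp Require Import measurable_realfun ring lra.

Set Implicit Arguments.
Unset Strict Implicit.
Unset Printing Implicit Defensive.

Import Order.TTheory GRing.Theory Num.Theory.
Import numFieldNormedType.Exports.

Local Open Scope classical_set_scope.
Local Open Scope ring_scope.

(** * Gaussian laws *)

Section Density.
Import HBNNSimple.

Lemma ge0_integral_density d (T : measurableType d) (R : realType)
    (mu nu : {measure set T -> \bar R}) (g : T -> R) :
  measurable_fun setT g -> (forall x, 0 <= g x) ->
  (forall A, measurable A -> nu A = \int[mu]_(x in A) (g x)%:E)%E ->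
  forall f : T -> \bar R, measurable_fun setT f -> (forall x, 0 <= f x)%E ->
  (\int[nu]_x f x = \int[mu]_x (f x * (g x)%:E))%E.
Proof.
move=> mg g0 nuE f mf f0.
have indicE' E : measurable E ->
    (\int[nu]_x (\1_E x)%:E = \int[mu]_x ((\1_E x)%:E * (g x)%:E))%E.
  move=> mE; rewrite integral_indic// setIT nuE// [LHS]integral_mkcond.
  apply: eq_integral => x _; rewrite patchE indicE.
  by case: ifPn => xE; rewrite ?mul1e ?mul0e.
pose f_ := nnsfun_approx measurableT mf.
have sfE (h : {nnsfun T >-> R}) :
    (\int[nu]_x (h x)%:E = \int[mu]_x ((h x)%:E * (g x)%:E))%E.
  under [LHS]eq_integral do rewrite fimfunE -fsumEFin//.
  rewrite [LHS]ge0_integral_fsum//; last 2 first.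
    - by move=> r; exact/measurable_EFinP/measurableT_comp.
    - by move=> n x _; rewrite EFinM nnfun_muleindic_ge0.
  under [RHS]eq_integral.
    move=> x xD; rewrite fimfunE -fsumEFin// muleC ge0_mule_fsumr; last first.
      by move=> r; rewrite EFinM nnfun_muleindic_ge0.
    over.
  rewrite [RHS]ge0_integral_fsum//; last 2 first.
    - move=> r; apply: emeasurable_funM; first exact/measurable_EFinP.
      by apply/measurable_EFinP/measurableT_comp.
    - move=> n x _; rewrite EFinM mule_ge0//; last by rewrite nnfun_muleindic_ge0.
      by rewrite lee_fin.
  apply: eq_fsbigr => r rh.
  have r0 : 0 <= r by move: rh; rewrite inE => -[x _ <-].
  rewrite integralZl_indic_nnsfun// indicE'// -ge0_integralZl//.
  - by apply: eq_integral => x _; rewrite [in RHS]EFinM [RHS]muleC muleA.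
  - by apply: emeasurable_funM; apply/measurable_EFinP.
  - by move=> x _; rewrite mule_ge0 ?lee_fin.
transitivity (lim (\int[nu]_x (f_ n x)%:E @[n --> \oo])%E).
  rewrite -monotone_convergence//=.
  - apply: eq_integral => ? /[!inE] xD; apply/esym/cvg_lim => //=.
    exact: cvg_nnsfun_approx.
  - by move=> n; exact/measurable_EFinP/measurable_funTS.
  - by move=> n ? _; rewrite lee_fin.
  - by move=> ? _ ? ? mn; rewrite lee_fin; exact/lefP/nd_nnsfun_approx.
under eq_fun do rewrite sfE.
rewrite -monotone_convergence//=.
- apply: eq_integral => x _; apply/cvg_lim => //=.
  apply: (@cvgeZr _ _ _ (fun n => (f_ n x)%:E) (f x) (g x)%:E) => //.
  exact: cvg_nnsfun_approx.
- by move=> n; apply: emeasurable_funM; apply/measurable_EFinP.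
- by move=> n x _; rewrite mule_ge0 ?lee_fin.
- move=> x _ a b ab; rewrite lee_wpmul2r ?lee_fin//.
  exact/lefP/nd_nnsfun_approx.
Qed.

End Density.

Lemma ge0_integral_normal_prob (R : realType) (s : R) (f : R -> R) :
  0 < s -> continuous f -> (forall x, 0 <= f x) ->
  (\int[normal_prob 0 s]_x (f x)%:E
   = \int[normal_prob 0 1]_x (f (s * x))%:E)%E.
Proof.
move=> s0 cf f0.
have mf : measurable_fun setT f by exact: continuous_measurable_fun.
have cfs : continuous (fun x => f (s * x)).
  by move=> x; apply: continuous_comp; [exact: mulrl_continuous|exact: cf].
have mfs : measurable_fun setT (fun x => f (s * x)).
  exact: continuous_measurable_fun.
have dens (r : R) (h : R -> R) : measurable_fun setT h -> (forall x, 0 <= h x) ->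
    (\int[normal_prob 0 r]_x (h x)%:E
     = \int[lebesgue_measure]_x ((h x)%:E * (normal_pdf 0 r x)%:E))%E.
  move=> mh h0; apply: ge0_integral_density => //.
  - exact: measurable_normal_pdf.
  - by move=> x; exact: normal_pdf_ge0.
  - exact/measurable_EFinP.
rewrite (dens s f mf f0) (dens 1 _ mfs (fun x => f0 (s * x))).
under eq_integral do rewrite -EFinM.
have dF : (fun x : R => s * x)^`()%classic = cst s.
  apply/funext => x; rewrite derive1E deriveM// derive_cst scaler0 addr0.
  by rewrite derive_id scaler1.
rewrite (@increasing_ge0_integration_by_substitutionT _ (fun x => s * x)
  (fun x => f x * normal_pdf 0 s x)).
- apply: eq_integral => x _; rewrite -EFinM; congr (_%:E).
  rewrite !fctE dF /cst -mulrA; congr (_ * _).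
  rewrite !normal_pdfE ?gt_eqF// /normal_peak /normal_fun !subr0.
  rewrite mulrAC; congr (_ * _).
    rewrite expr1n mul1r -mulrnAr sqrtrM ?sqr_ge0// sqrtr_sqr gtr0_norm//.
    by rewrite invfM mulrAC mulVf ?gt_eqF// mul1r.
  congr (expR _).
  by field; rewrite gt_eqF.
- by move=> x y xy; rewrite ltr_pM2l.
- by rewrite dF => ?; exact: cvg_cst.
- by rewrite dF; exact: is_cvg_cst.
- by rewrite dF; exact: is_cvg_cst.
- by [].
- by apply/gt0_cvgMrNy => //; exact: cvg_id.
- by apply/gt0_cvgMry => //; exact: cvg_id.
- move=> x; apply: cvgM; first exact: cf.
  by apply: continuous_normal_pdf; rewrite gt_eqF.
- by move=> x; rewrite mulr_ge0// normal_pdf_ge0.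
Qed.

Lemma normal_prob_sqr_lty (R : realType) :
  (\int[@normal_prob R 0 1]_x (x ^+ 2)%:E < +oo)%E.
Proof.
rewrite (@ge0_integral_density _ _ _ lebesgue_measure _ (normal_pdf 0 1))//;
  last 4 first.
  exact: measurable_normal_pdf.
  by move=> x; exact: normal_pdf_ge0.
  by apply/measurable_EFinP; exact: measurable_funX.
  by move=> x; rewrite lee_fin sqr_ge0.
pose s : R := Num.sqrt 2.
have s0 : s != 0 by rewrite gt_eqF// sqrtr_gt0.
pose C : R := 4 * normal_peak 1 / normal_peak s.
have pk0 (t : R) : t != 0 -> 0 < normal_peak t by exact: normal_peak_gt0.
have C0 : 0 <= C.
  by rewrite /C divr_ge0 ?mulr_ge0// ?normal_peak_ge0.
apply: (@le_lt_trans _ _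
  (\int[lebesgue_measure]_x (C%:E * (normal_pdf 0 s x)%:E))%E); last first.
  rewrite ge0_integralZl//.
  - by rewrite integral_normal_pdf mule1 ltry.
  - by apply/measurable_EFinP; exact: measurable_normal_pdf.
  - by move=> x _; rewrite lee_fin normal_pdf_ge0.
apply: ge0_le_integral => //.
- by move=> x _; rewrite -EFinM lee_fin mulr_ge0 ?sqr_ge0 ?normal_pdf_ge0.
- apply: emeasurable_funM; apply/measurable_EFinP; first exact: measurable_funX.
  exact: measurable_normal_pdf.
- apply: emeasurable_funM; first by [].
  by apply/measurable_EFinP; exact: measurable_normal_pdf.
move=> x _; rewrite -!EFinM lee_fin !normal_pdfE ?oner_neq0// /C.
rewrite /normal_fun !subr0 sqr_sqrtr// expr1n.
rewrite [leRHS](_ : _ =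
  normal_peak 1 * (4 * expR (- x ^+ 2 / (2 *+ 2)))); last first.
  by field; rewrite gt_eqF// pk0.
rewrite mulrCA ler_pM2l ?pk0 ?oner_neq0//.
have -> : - x ^+ 2 / (1 *+ 2) = - x ^+ 2 / (2 *+ 2) - x ^+ 2 / (2 *+ 2).
  by field.
set u := x ^+ 2 / (2 *+ 2); rewrite mulNr -/u.
have -> : x ^+ 2 = 4 * u by rewrite /u; field.
rewrite -mulrA ler_pM2l// expRD mulrA ger_pMl ?expR_gt0// expRN.
by rewrite ler_pdivrMr ?expR_gt0// mul1r (le_trans _ (expR_ge1Dx _))// lerDr.
Qed.

Lemma normal_prob_lt_gt0 (R : realType) (s c : R) :
  0 < s -> (0 < normal_prob 0 s `]-oo, c])%E.
Proof.
move=> s0; rewrite /normal_prob.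
pose m := Num.min (normal_pdf 0 s (c - 1)) (normal_pdf 0 s c).
have pdf0 x : 0 < normal_pdf 0 s x.
  by rewrite normal_pdfE ?gt_eqF// mulr_gt0 ?expR_gt0// normal_peak_gt0// gt_eqF.
have m0 : 0 < m by rewrite lt_min !pdf0.
have mpdf : measurable_fun setT (fun x : R => (normal_pdf 0 s x)%:E).
  by apply/measurable_EFinP; exact: measurable_normal_pdf.
have pdfE0 (x : R) : (0 <= (normal_pdf 0 s x)%:E)%E.
  by rewrite lee_fin normal_pdf_ge0.
apply: (@lt_le_trans _ _ (\int[lebesgue_measure]_(x in `[(c - 1)%R, c]) m%:E)%E).
  rewrite integral_cst//= lebesgue_measure_itv/= lte_fin ltrBlDr ltrDl ltr01.
  by rewrite -EFinD mule_gt0// lte_fin// opprB addrC subrK.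
apply: (@le_trans _ _
  (\int[lebesgue_measure]_(x in `[(c - 1)%R, c]) (normal_pdf 0 s x)%:E)%E).
  apply: ge0_le_integral => //.
  - by move=> x _; rewrite lee_fin ltW.
  - exact: measurable_funTS.
  - move=> x; rewrite /= in_itv/= => /andP[cx xc].
    rewrite lee_fin /m ge_min !normal_pdfE ?gt_eqF//.
    rewrite !ler_pM2l ?normal_peak_gt0 ?gt_eqF//.
    rewrite !ler_expR !subr0 !mulNr !lerN2.
    rewrite !ler_pM2r ?invr_gt0 ?mulrn_wgt0 ?exprn_gt0//.
    have [x0|x0] := leP 0 x.
      by apply/orP; right; rewrite ler_sqr// nnegrE (le_trans x0).
    apply/orP; left; rewrite -sqrrN -[leRHS]sqrrN.
    by rewrite ler_sqr ?nnegrE; lra.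
apply: ge0_subset_integral => //; first exact: measurable_funTS.
by move=> x /=; rewrite !in_itv/= => /andP[].
Qed.

(** * Sub-sigma-algebras and independence *)

Section SubSigmaAlgebra.
Context d (T : measurableType d) (R : realType).
Implicit Types (G : set (set T)) (xi eta : T -> R).

Lemma measurable_wrtP G xi : sigma_algebra setT G ->
  measurable_wrt G xi <->
  measurable_fun (T := g_sigma_algebraType G) setT xi.
Proof.
move=> sG; split => [mxi _ B mB|mxi B mB].
  by rewrite setTI; apply: sub_sigma_algebra; exact: mxi.
have := mxi measurableT B mB; rewrite setTI /measurable/=.
by rewrite sigma_algebra_id.
Qed.

Lemma measurable_wrtM G xi eta : sigma_algebra setT G ->
  measurable_wrt G xi -> measurable_wrt G eta ->
  measurable_wrt G (fun w => xi w * eta w).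
Proof.
move=> sG /(measurable_wrtP _ sG) mx /(measurable_wrtP _ sG) me.
by apply/measurable_wrtP => //; exact: measurable_funM.
Qed.

Lemma measurable_wrtB G xi eta : sigma_algebra setT G ->
  measurable_wrt G xi -> measurable_wrt G eta ->
  measurable_wrt G (fun w => xi w - eta w).
Proof.
move=> sG /(measurable_wrtP _ sG) mx /(measurable_wrtP _ sG) me.
by apply/measurable_wrtP => //; exact: measurable_funB.
Qed.

Lemma measurable_wrt_cst G (c : R) : sigma_algebra setT G ->
  measurable_wrt G (fun=> c : R).
Proof. by move=> sG; apply/measurable_wrtP. Qed.

Lemma measurable_wrt_indic G (A : set T) : sigma_algebra setT G -> G A ->
  measurable_wrt G (\1_A : T -> R).
Proof.
move=> sG GA; apply/measurable_wrtP => //.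
by apply: (@measurable_indic _ (g_sigma_algebraType G)); exact: sub_sigma_algebra.
Qed.

Lemma measurable_wrt_fun G xi : G `<=` measurable -> measurable_wrt G xi ->
  measurable_fun setT xi.
Proof. by move=> Gm mxi _ B mB; rewrite setTI; apply/Gm/mxi. Qed.

Lemma measurable_wrt_sub G G' xi : G `<=` G' -> measurable_wrt G xi ->
  measurable_wrt G' xi.
Proof. by move=> GG' mxi B mB; apply/GG'/mxi. Qed.

End SubSigmaAlgebra.

Lemma independent_of_distribution d (T : measurableType d) (R : realType)
    (P : probability T R) (G : set (set T)) (X Z : {RV P >-> R})
    (XZ : {RV P >-> (R * R)%type}) :
  measurable_wrt G X -> independent_of P G Z ->
  (forall w, XZ w = (X w, Z w)) ->
  forall A, measurable A ->
  (distribution P X \x distribution P Z)%E A = distribution P XZ A.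
Proof.
move=> mX iZ XZE; apply: product_measure_unique => A B mA mB.
rewrite /distribution /pushforward -iZ//; last exact: mX.
by congr (P _); apply/seteqP; split => w /=; rewrite XZE.
Qed.

Lemma Rintegral_indepM d (T : measurableType d) (R : realType)
    (P : probability T R) (G : set (set T)) (X Z : T -> R) :
  G `<=` measurable -> measurable_wrt G X -> measurable_fun setT Z ->
  independent_of P G Z ->
  P.-integrable setT (EFin \o X) -> P.-integrable setT (EFin \o Z) ->
  P.-integrable setT (EFin \o (fun w => X w * Z w)) /\
  \int[P]_w (X w * Z w) = (\int[P]_w X w) * (\int[P]_w Z w).
Proof.
move=> Gm GX mZ iZ iX iZ'.
have mX : measurable_fun setT X by exact: measurable_wrt_fun GX.
have mXZ : measurable_fun setT (fun w => (X w, Z w)).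
  exact: measurable_fun_pair.
pose X' : {RV P >-> R} := HB.pack X (isMeasurableFun.Build _ _ _ _ X mX).
pose Z' : {RV P >-> R} := HB.pack Z (isMeasurableFun.Build _ _ _ _ Z mZ).
pose XZ : {RV P >-> (R * R)%type} :=
  HB.pack (fun w => (X w, Z w)) (isMeasurableFun.Build _ _ _ _ _ mXZ).
pose mu := distribution P X'; pose nu := distribution P Z'.
have lawE A : measurable A -> distribution P XZ A = (mu \x nu)%E A.
  by move=> mA; rewrite (@independent_of_distribution _ _ _ _ G X' Z' XZ).
have mmul : measurable_fun [set: R * R] (fun z : R * R => z.1 * z.2).
  by apply: measurable_funM.
have mXf (f : R -> R) : measurable_fun setT f ->
    measurable_fun [set: R] (EFin \o f) by move=> mf; exact/measurable_EFinP.
have iXn := integrable_fin_num measurableT (integrable_abse iX).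
have iZn := integrable_fin_num measurableT (integrable_abse iZ').
have imu : mu.-integrable setT EFin.
  apply/integrableP; split; first exact/measurable_EFinP.
  rewrite ge0_integral_distribution//; first by case/integrableP: iX.
  by apply: measurableT_comp => //; exact/measurable_EFinP.
have inu : nu.-integrable setT EFin.
  apply/integrableP; split; first exact/measurable_EFinP.
  rewrite ge0_integral_distribution//; first by case/integrableP: iZ'.
  by apply: measurableT_comp => //; exact/measurable_EFinP.
have nufin := integrable_fin_num measurableT inu.
have nuafin := integrable_fin_num measurableT (integrable_abse inu).
have iprod : (mu \x nu)%E.-integrable setT (fun z : R * R => (z.1 * z.2)%:E).
  apply/integrable12ltyP; first exact/measurable_EFinP.
  have -> : (\int[mu]_x \int[nu]_y `|(x * y)%:E| =
      \int[mu]_x (`|x%:E| * \int[nu]_y `|y%:E|))%E.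
    apply: eq_integral => x _; rewrite -ge0_integralZl//=.
    - by apply: eq_integral => y _; rewrite normrM EFinM.
    - by apply: measurableT_comp => //; exact/measurable_EFinP.
  rewrite ge0_integralZr//.
  - rewrite lte_mul_pinfty//; first exact: integral_ge0.
      exact: (integrable_fin_num measurableT (integrable_abse imu)).
    by rewrite ltey_eq nuafin.
  - by apply: measurableT_comp => //; exact/measurable_EFinP.
  - exact: integral_ge0.
have iXZ : P.-integrable setT (EFin \o (fun w => X w * Z w)).
  apply/integrableP; split.
    by apply/measurable_EFinP; exact: measurable_funM.
  have /integrableP[_] := iprod.
  rewrite -(eq_measure_integral (mu \x nu)%E (m1 := distribution P XZ)).
    rewrite ge0_integral_distribution//.
    by apply: measurableT_comp => //; exact/measurable_EFinP.
  by move=> A mA _; exact: lawE.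
split=> //; rewrite /Rintegral.
have -> : (\int[P]_w (X w * Z w)%:E = \int[(mu \x nu)%E]_z (z.1 * z.2)%:E)%E.
  rewrite -(eq_measure_integral (mu \x nu)%E (m1 := distribution P XZ)).
    by rewrite integral_distribution//; exact/measurable_EFinP.
  by move=> A mA _; exact: lawE.
rewrite -integral12_prod_meas1//.
have -> : (\int[P]_w (X w)%:E = \int[mu]_x x%:E)%E.
  by rewrite integral_distribution.
have -> : (\int[P]_w (Z w)%:E = \int[nu]_x x%:E)%E.
  by rewrite integral_distribution.
have -> : (\int[mu]_x fubini_F nu (fun z : R * R => (z.1 * z.2)%:E) x =
    \int[mu]_x (x%:E * (fine (\int[nu]_y y%:E))%:E))%E.
  apply: eq_integral => x _; rewrite /fubini_F fineK// -integralZl//.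
rewrite integralZr// fineM//.
exact: (integrable_fin_num measurableT imu).
Qed.

Lemma continuous_max0 (R : realType) (f : R -> R) :
    {within `[0, +oo[, continuous f} ->
  continuous (fun t : R => f (Num.max 0 t)).
Proof.
move=> /subspace_continuousP cf x.
have x0 : `[0, +oo[%classic (Num.max 0 x) by rewrite /= in_itv/= andbT le_max lexx.
have cm : Num.max 0 t @[t --> (x : R)] --> Num.max 0 x.
  by apply: (@continuous_max R R (fun=> 0) id x); [exact: cvg_cst|exact: cvg_id].
move=> U /(cf _ x0) /= /cm; rewrite !nbhs_simpl/=; apply: filterS => t /=.
by apply; rewrite /= in_itv/= andbT le_max lexx.
Qed.

Lemma measurable_continuous_process d (T : measurableType d) (R : realType)
    (X : R -> T -> R) :
  (forall t, 0 <= t -> measurable_fun setT (X t)) -> continuous_process X ->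
  measurable_fun setT (fun z : T * R => X (Num.max 0 z.2) z.1).
Proof.
move=> mX cX.
pose k n (s : R) : nat := Num.truncn (n.+1%:R * Num.max 0 s).
have m0 (s : R) : 0 <= Num.max 0 s by rewrite le_max lexx.
pose h n (z : T * R) := X ((k n z.2)%:R / n.+1%:R) z.1.
apply: (measurable_fun_cvg (h := h)).
- move=> n _ B mB; rewrite setTI.
  have -> : h n @^-1` B = \bigcup_j
    ((X (j%:R / n.+1%:R) @^-1` B) `*` [set s | k n s = j]).
    apply/seteqP; split => [[w s] /= hB|[w s] [j _ [/= Bj kj]]].
      by exists (k n s).
    by rewrite /h /= kj.
  apply: bigcup_measurable => j _; apply: measurableX.
    have j0 : 0 <= j%:R / n.+1%:R :> R by rewrite divr_ge0.
    by rewrite -[X in measurable X]setTI; exact: (mX _ j0).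
  have -> : [set s | k n s = j] =
      (fun s => n.+1%:R * Num.max 0 s) @^-1` `[j%:R, j.+1%:R[.
    apply/seteqP; split => s /=; rewrite /k in_itv/=.
      by move=> <-; rewrite truncn_itv// mulr_ge0.
    by move=> /truncn_def.
  rewrite -[X in measurable X]setTI.
  by apply: measurable_funM => //; exact: measurable_maxr.
- move=> [w s] _ /=.
  pose t n : R := (k n s)%:R / n.+1%:R.
  have t0 n : 0 <= t n by rewrite divr_ge0.
  have ct : t n @[n --> \oo] --> Num.max 0 s.
    apply: (@squeeze_cvgr _ _ _ _ (fun n => Num.max 0 s - n.+1%:R^-1)
      (fun=> Num.max 0 s)).
    + near=> n; rewrite /t.
      have /andP[t1 t2] : (k n s)%:R <= n.+1%:R * Num.max 0 s < (k n s).+1%:R.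
        by apply: truncn_itv; rewrite mulr_ge0.
      apply/andP; split; last by rewrite ler_pdivrMr// [leRHS]mulrC.
      rewrite ler_pdivlMr// mulrBl mulVf// lerBlDr [leLHS]mulrC.
      by rewrite natr1; exact: ltW.
    + rewrite -[X in _ --> X]subr0; apply: cvgB; first exact: cvg_cst.
      exact: cvg_harmonic.
    + exact: cvg_cst.
  have hE : (fun n => h n (w, s)) = (fun u => X (Num.max 0 u) w) \o t.
    by apply/funext => n; rewrite /h/= max_r.
  have -> : X (Num.max 0 s) w = X (Num.max 0 (Num.max 0 s)) w.
    by rewrite [in RHS]max_r.
  rewrite hE; apply: (cvg_comp _ _ ct).
  exact: (@continuous_max0 R (fun u => X u w) (cX w) (Num.max 0 s)).
Unshelve. all: by end_near. Qed.

Section HasIntegral.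
Context d (T : measurableType d) (R : realType).
Context (mu : {measure set T -> \bar R}).
Implicit Types (f g : T -> R) (a b : R).

Definition has_integral f a : Prop :=
  mu.-integrable setT (EFin \o f) /\ \int[mu]_x f x = a.

Lemma has_integral_EFin f a :
  has_integral f a -> (\int[mu]_x (f x)%:E = a%:E)%E.
Proof.
by move=> [fi <-]; rewrite /Rintegral fineK//; exact: integrable_fin_num.
Qed.

Lemma eq_has_integral f g a : f =1 g -> has_integral f a -> has_integral g a.
Proof. by move=> /funext ->. Qed.

Lemma has_integralD f g a b : has_integral f a -> has_integral g b ->
  has_integral (fun x => f x + g x) (a + b).
Proof.
move=> [fi <-] [gi <-]; split; last by rewrite RintegralD.
rewrite (_ : EFin \o _ = (EFin \o f) \+ (EFin \o g))%E//.
exact: integrableD.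
Qed.

Lemma has_integralZ k f a : has_integral f a ->
  has_integral (fun x => k * f x) (k * a).
Proof.
move=> [fi <-]; split; last by rewrite RintegralZl.
rewrite (_ : EFin \o _ = (fun x => k%:E * (EFin \o f) x)%E)//.
exact: integrableZl.
Qed.

Lemma has_integral0 : has_integral (fun=> 0) 0.
Proof.
split; first exact: integrable0.
by rewrite /Rintegral integral0.
Qed.

Lemma has_integral_sum (I : finType) (f : I -> T -> R) (a : I -> R) :
  (forall i, has_integral (f i) (a i)) ->
  has_integral (fun x => \sum_i f i x) (\sum_i a i).
Proof.
move=> fa; rewrite -!big_enum/=.
rewrite (_ : (fun x => _) = (fun x => \sum_(i <- enum I) f i x)); last first.
  by apply/funext => x; rewrite -big_enum.
elim: (enum I) => [|i s IHs].
  rewrite big_nil; apply: eq_has_integral has_integral0 => x.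
  by rewrite big_nil.
rewrite big_cons; apply: eq_has_integral (has_integralD (fa i) IHs) => x.
by rewrite big_cons.
Qed.

Lemma integrable_boundedM f g C : measurable_fun setT f ->
  (forall x, `|f x| <= C) -> mu.-integrable setT (EFin \o g) ->
  mu.-integrable setT (EFin \o (fun x => f x * g x)).
Proof.
move=> mf fC gi.
rewrite (_ : EFin \o _ = (EFin \o f) \* (EFin \o g))%E//.
apply: integrableMr => //; exists C; split; first exact: num_real.
by move=> M CM x _; exact: le_trans (fC x) (ltW CM).
Qed.

End HasIntegral.

Section NormalMoments.
Context d (T : measurableType d) (R : realType).

Definition normal_mean : R := \int[@normal_prob R 0 1]_x x.
Definition normal_second_moment : R := \int[@normal_prob R 0 1]_x (x ^+ 2).

Lemma normal_sqr_has_integral :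
  has_integral (@normal_prob R 0 1) (fun x => x ^+ 2) normal_second_moment.
Proof.
split=> //; apply/integrableP; split.
  by apply/measurable_EFinP; exact: measurable_funX.
under eq_integral do rewrite /= ger0_norm ?sqr_ge0//.
exact: normal_prob_sqr_lty.
Qed.

Lemma normal_second_moment_ge0 : 0 <= normal_second_moment.
Proof. by apply: Rintegral_ge0 => x _; exact: sqr_ge0. Qed.

Lemma has_integral_cst1 d' (T' : measurableType d') (P : probability T' R)
  (c : R) : has_integral P (fun=> c) c.
Proof.
split; first exact: finite_measure_integrable_cst.
rewrite Rintegral_cst// [X in fine X](_ : _ = 1%E) ?mulr1//.
exact: probability_setT.
Qed.

Lemma normal_mean_has_integral :
  has_integral (@normal_prob R 0 1) id normal_mean.
Proof.
split=> //.
have := has_integralD (has_integral_cst1 (@normal_prob R 0 1) 1)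
  normal_sqr_has_integral.
move=> [+ _]; apply: le_integrable => //; first exact/measurable_EFinP.
move=> x _ /=; rewrite lee_fin [leRHS]ger0_norm ?addr_ge0 ?sqr_ge0//.
by rewrite -real_normK ?num_real//; nra.
Qed.

Context (P : probability T R) (Z : T -> R) (s : R).
Context (mZ : measurable_fun setT Z) (s0 : 0 < s)
  (lawZ : forall B, measurable B -> P (Z @^-1` B) = normal_prob 0 s B).

Let ge0_transfer (g : R -> R) a : continuous g -> (forall x, 0 <= g x) ->
  has_integral (normal_prob 0 1) (fun x => g (s * x)) a ->
  has_integral P (fun w => g (Z w)) a.
Proof.
move=> cg g0 ga.
have mg : measurable_fun setT g by exact: continuous_measurable_fun.
pose Z' : {RV P >-> measurableTypeR R} :=
  HB.pack (Z : T -> measurableTypeR R)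
    (isMeasurableFun.Build _ _ T (measurableTypeR R) Z mZ).
have E : (\int[P]_w (g (Z w))%:E = a%:E)%E.
  rewrite -(has_integral_EFin ga) -(ge0_integral_normal_prob s0 cg g0).
  transitivity (\int[distribution P Z']_y (g y)%:E)%E.
    by rewrite ge0_integral_distribution//; exact/measurable_EFinP.
  by apply: (eq_measure_integral (normal_prob 0 s)) => A mA _; exact: lawZ.
split; last by rewrite /Rintegral E.
apply/integrableP; split; first by apply/measurable_EFinP; exact: measurableT_comp.
rewrite (eq_integral (fun w => (g (Z w))%:E)) ?E ?ltry//.
by move=> w _ /=; rewrite ger0_norm.
Qed.

Lemma normal_law_sqr :
  has_integral P (fun w => Z w ^+ 2) (s ^+ 2 * normal_second_moment).
Proof.
apply: (@ge0_transfer (fun x => x ^+ 2)).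
- exact: sqr_continuous.
- by move=> x; exact: sqr_ge0.
- apply: eq_has_integral (has_integralZ (s ^+ 2) normal_sqr_has_integral) => x.
  by rewrite exprMn.
Qed.

(* [x = ((x + 1)^2 - x^2 - 1) / 2] reduces the mean to nonnegative integrands. *)
Lemma normal_law_mean : has_integral P Z (s * normal_mean).
Proof.
have sq1 : has_integral P (fun w => (Z w + 1) ^+ 2)
    (s ^+ 2 * normal_second_moment + (2 * s) * normal_mean + 1).
  apply: (@ge0_transfer (fun x => (x + 1) ^+ 2)).
  - move=> x; apply: (@continuous_comp _ _ _ (fun x : R => x + 1)
      (fun x : R => x ^+ 2)); last exact: sqr_continuous.
    by apply: cvgD; [exact: cvg_id|exact: cvg_cst].
  - by move=> x; exact: sqr_ge0.
  - apply: eq_has_integral (has_integralD (has_integralD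
      (has_integralZ (s ^+ 2) normal_sqr_has_integral)
      (has_integralZ (2 * s) normal_mean_has_integral))
      (has_integral_cst1 _ 1)) => x /=; ring.
have := has_integralZ (2^-1) (has_integralD sq1 (has_integralZ (-1)
  (has_integralD normal_law_sqr (has_integral_cst1 P 1)))).
have -> : 2^-1 * (s ^+ 2 * normal_second_moment + 2 * s * normal_mean + 1 +
  -1 * (s ^+ 2 * normal_second_moment + 1)) = s * normal_mean by field.
by apply: eq_has_integral => w; field.
Qed.

End NormalMoments.

(** * Isometry for elementary integrands *)

Section BrownianIncrements.
Context d (T : measurableType d) (R : realType) (P : probability T R).
Context (F : R -> set (set T)) (W : R -> T -> R).
Context (fF : filtration F) (bW : brownian_motion P F W).
Implicit Types (xi eta : T -> R) (a b c e s t : R).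

Definition bounded_wrt (G : set (set T)) xi : Prop :=
  measurable_wrt G xi /\ exists C : R, forall w, `|xi w| <= C.

Lemma filtration_sub s t : 0 <= s -> s <= t -> F s `<=` F t.
Proof. by case: fF => _; apply. Qed.

Lemma filtration_measurable t : 0 <= t -> F t `<=` measurable.
Proof. by case: fF => + _ t0 => /(_ t t0)[]. Qed.

Lemma filtration_sigma t : 0 <= t -> sigma_algebra setT (F t).
Proof. by case: fF => + _ t0 => /(_ t t0)[]. Qed.

Lemma bounded_wrtM s xi eta : 0 <= s -> bounded_wrt (F s) xi ->
  bounded_wrt (F s) eta -> bounded_wrt (F s) (fun w => xi w * eta w).
Proof.
move=> s0 [mx [C xC]] [me [D eD]]; split.
  by apply: measurable_wrtM => //; exact: filtration_sigma.
by exists (C * D) => w; rewrite normrM ler_pM.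
Qed.

Lemma bounded_wrt_le s t xi : 0 <= s -> s <= t -> bounded_wrt (F s) xi ->
  bounded_wrt (F t) xi.
Proof.
move=> s0 st [mx bx]; split=> //.
by apply: measurable_wrt_sub mx; exact: filtration_sub.
Qed.

Lemma bounded_wrt_indic s (A : set T) : 0 <= s -> F s A ->
  bounded_wrt (F s) (\1_A : T -> R).
Proof.
move=> s0 FA; split.
  by apply: measurable_wrt_indic => //; exact: filtration_sigma.
by exists 1 => w; rewrite indicE ger0_norm// lern1 leq_b1.
Qed.

Lemma bounded_wrt_cst s (k : R) : 0 <= s -> bounded_wrt (F s) (fun=> k).
Proof.
move=> s0; split; first by apply: measurable_wrt_cst; exact: filtration_sigma.
by exists `|k|.
Qed.

Lemma bounded_wrt_integrable s xi : 0 <= s -> bounded_wrt (F s) xi ->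
  has_integral P xi (\int[P]_w xi w).
Proof.
move=> s0 [mx [C xC]]; split=> //.
have := @integrable_boundedM _ _ _ P xi (fun=> 1) C _ xC
  (has_integral_cst1 P 1).1.
rewrite (_ : EFin \o (fun x => xi x * 1) = EFin \o xi); last first.
  by apply/funext => w /=; rewrite mulr1.
by apply; apply: measurable_wrt_fun mx; exact: filtration_measurable.
Qed.

Definition increment s t w := W t w - W s w.

Lemma adaptedW t : 0 <= t -> measurable_wrt (F t) (W t).
Proof. by case: bW => _ + _ _ _; apply. Qed.

Lemma measurable_wrt_increment s t e : 0 <= s -> s <= t -> t <= e ->
  measurable_wrt (F e) (increment s t).
Proof.
move=> s0 st te; have t0 := le_trans s0 st; have e0 := le_trans t0 te.
apply: measurable_wrtB; first exact: filtration_sigma.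
  by apply: measurable_wrt_sub (adaptedW t0); exact: filtration_sub.
apply: measurable_wrt_sub (adaptedW s0); apply: filtration_sub => //.
exact: le_trans te.
Qed.

Lemma measurable_increment s t : 0 <= s -> s <= t ->
  measurable_fun setT (increment s t).
Proof.
move=> s0 st; have t0 := le_trans s0 st.
apply: measurable_wrt_fun (measurable_wrt_increment s0 st (lexx t)).
exact: filtration_measurable.
Qed.

Lemma increment_independent s t : 0 <= s -> s < t ->
  independent_of P (F s) (increment s t).
Proof. by case: bW => _ _ _ + _; apply. Qed.

Lemma increment_law s t : 0 <= s -> s < t -> forall B, measurable B ->
  P (increment s t @^-1` B) = normal_prob 0 (Num.sqrt (t - s)) B.
Proof. by case: bW => _ _ _ _ + *; apply. Qed.

(* Adding the increments over [0, 1] and [1, 2] turns the scaling law into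
   [sqrt 2 * m = m + m]. *)
Lemma normal_mean0 : normal_mean R = 0.
Proof.
have inc s t : 0 <= s -> s < t ->
    has_integral P (increment s t) (Num.sqrt (t - s) * normal_mean R).
  move=> s0 st; apply: normal_law_mean.
  - by apply: measurable_increment => //; exact: ltW.
  - by rewrite sqrtr_gt0 subr_gt0.
  - exact: increment_law.
have lt01 : 0 < 1 :> R by []. have lt12 : 1 < 2 :> R by rewrite ltr1n.
have lt02 : 0 < 2 :> R by [].
have [_ E] := has_integralD (inc 0 1 (lexx 0) lt01) (inc 1 2 ler01 lt12).
have [_] := inc 0 2 (lexx 0) lt02.
rewrite (_ : increment 0 2 = (fun w => increment 0 1 w + increment 1 2 w));
  last by apply/funext => w; rewrite /increment; ring.
rewrite E; have -> : 2 - 1 = 1 :> R by ring.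
rewrite !subr0 sqrtr1 mul1r => H.
have s2 : Num.sqrt 2 < 2 :> R.
  rewrite -[ltRHS]ger0_norm// -sqrtr_sqr ltr_sqrt ?exprn_gt0//.
  by rewrite expr2 ltr_pMl// ltr1n.
have /eqP : (2 - Num.sqrt 2) * normal_mean R = 0.
  by rewrite mulrBl -H; ring.
by rewrite mulf_eq0 subr_eq0 gt_eqF//= => /eqP.
Qed.

Lemma increment_mean s t : 0 <= s -> s <= t ->
  has_integral P (increment s t) 0.
Proof.
move=> s0; rewrite le_eqVlt => /predU1P[<-|st].
  by apply: eq_has_integral (has_integral0 P) => w; rewrite /increment subrr.
rewrite -(mulr0 (Num.sqrt (t - s))) -normal_mean0; apply: normal_law_mean.
- by apply: measurable_increment => //; exact: ltW.
- by rewrite sqrtr_gt0 subr_gt0.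
- exact: increment_law.
Qed.

Lemma increment_sqr s t : 0 <= s -> s <= t ->
  has_integral P (fun w => increment s t w ^+ 2)
    ((t - s) * normal_second_moment R).
Proof.
move=> s0; rewrite le_eqVlt => /predU1P[<-|st].
  rewrite subrr mul0r; apply: eq_has_integral (has_integral0 P) => w.
  by rewrite /increment subrr expr0n.
have ts : 0 <= t - s by rewrite subr_ge0 ltW.
rewrite -[in X in has_integral _ _ X](sqr_sqrtr ts); apply: normal_law_sqr.
- by apply: measurable_increment => //; exact: ltW.
- by rewrite sqrtr_gt0 subr_gt0.
- exact: increment_law.
Qed.

Lemma mul_increment s t xi : 0 <= s -> s <= t ->
  measurable_wrt (F s) xi -> P.-integrable setT (EFin \o xi) ->
  has_integral P (fun w => xi w * increment s t w) 0.
Proof.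
move=> s0; rewrite le_eqVlt => /predU1P[<-|st] mx ix.
  apply: eq_has_integral (has_integral0 P) => w.
  by rewrite /increment subrr mulr0.
have [iD D0] := increment_mean s0 (ltW st).
have [H E] := Rintegral_indepM (filtration_measurable s0) mx
  (measurable_increment s0 (ltW st)) (increment_independent s0 st) ix iD.
by split=> //; rewrite E D0 mulr0.
Qed.

Lemma mul_increment_sqr s t xi : 0 <= s -> s <= t -> bounded_wrt (F s) xi ->
  has_integral P (fun w => xi w * increment s t w ^+ 2)
    ((t - s) * normal_second_moment R * \int[P]_w xi w).
Proof.
move=> s0; rewrite le_eqVlt => /predU1P[<-|st] bx.
  rewrite subrr !mul0r; apply: eq_has_integral (has_integral0 P) => w.
  by rewrite /increment subrr expr0n mulr0.
have [iD D2] := increment_sqr s0 (ltW st).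
have [ix _] := bounded_wrt_integrable s0 bx.
have msq : measurable_fun setT (fun x : R => x ^+ 2) by exact: measurable_funX.
have ind : independent_of P (F s) (fun w => increment s t w ^+ 2).
  move=> A B FA mB.
  have := increment_independent s0 st FA (msq measurableT B mB).
  by rewrite setTI.
have [H E] := Rintegral_indepM (filtration_measurable s0) bx.1
  (measurable_funX 2 (measurable_increment s0 (ltW st))) ind ix iD.
by split=> //; rewrite E D2 mulrC.
Qed.

Lemma mul_increments_disjoint a b c e xi : 0 <= a -> a <= b -> b <= c ->
  c <= e -> bounded_wrt (F c) xi ->
  has_integral P (fun w => xi w * increment a b w * increment c e w) 0.
Proof.
move=> a0 ab bc ce [mx [C xC]].
have c0 : 0 <= c by rewrite (le_trans a0)// (le_trans ab).
apply: mul_increment => //.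
  apply: measurable_wrtM => //; first exact: filtration_sigma.
  exact: measurable_wrt_increment.
apply: (@integrable_boundedM _ _ _ P _ _ C) => //.
  by apply: measurable_wrt_fun mx; exact: filtration_measurable.
exact: (increment_mean a0 ab).1.
Qed.

Lemma mul_increments_same_start b c e xi : 0 <= c -> c <= b -> c <= e ->
  bounded_wrt (F c) xi ->
  has_integral P (fun w => xi w * increment c b w * increment c e w)
    ((Num.min b e - c) * normal_second_moment R * \int[P]_w xi w).
Proof.
wlog be : b e / b <= e => [hw|].
  have [be|/ltW eb] := leP b e; first by have := @hw b e; rewrite min_l; auto.
  move=> c0 cb ce bx; have := hw e b eb c0 ce cb bx.
  by rewrite min_l//; apply: eq_has_integral => w; rewrite mulrAC.
rewrite min_l// => c0 cb ce bx.
rewrite -[X in has_integral _ _ X]addr0.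
apply: eq_has_integral (has_integralD (mul_increment_sqr c0 cb bx)
  (@mul_increments_disjoint c b b e xi c0 cb (lexx _) be
    (bounded_wrt_le c0 cb bx))) => w.
by rewrite /increment; ring.
Qed.

Definition overlap a b c e := Num.max 0 (Num.min b e - Num.max a c).

Lemma mul_increments a b c e xi eta : 0 <= a -> a <= b -> 0 <= c -> c <= e ->
  bounded_wrt (F a) xi -> bounded_wrt (F c) eta ->
  has_integral P
    (fun w => (xi w * increment a b w) * (eta w * increment c e w))
    (normal_second_moment R * (overlap a b c e * \int[P]_w (xi w * eta w))).
Proof.
wlog ac : a b c e xi eta / a <= c => [hw|] a0 ab c0 ce bx be.
  have [ac|/ltW ca] := leP a c; first exact: hw.
  have := hw c e a b eta xi ca c0 ce a0 ab be bx.
  rewrite (_ : overlap c e a b = overlap a b c e); last first.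
    by rewrite /overlap [Num.min e b]minC [Num.max c a]maxC.
  rewrite (_ : (fun w => eta w * xi w) = (fun w => xi w * eta w)); last first.
    by apply/funext => w; rewrite mulrC.
  by apply: eq_has_integral => w; rewrite mulrC.
have bz : bounded_wrt (F c) (fun w => xi w * eta w).
  by apply: bounded_wrtM => //; exact: bounded_wrt_le bx.
rewrite /overlap (max_r ac).
have [bc|/ltW cb] := leP b c.
  rewrite (_ : Num.max _ _ = 0); last first.
    by apply/max_l; rewrite subr_le0 ge_min bc.
  rewrite mul0r mulr0.
  apply: eq_has_integral (mul_increments_disjoint a0 ab bc ce bz) => w; ring.
rewrite max_r; last by rewrite subr_ge0 le_min cb ce.
rewrite -[X in has_integral _ _ X]add0r mulrCA mulrA.
apply: eq_has_integral (has_integralD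
  (mul_increments_disjoint a0 ac (lexx c) ce bz)
  (mul_increments_same_start c0 cb ce bz)) => w.
rewrite /increment; ring.
Qed.

End BrownianIncrements.

Lemma has_integral_overlap (R : realType) (a b c e : R) :
  has_integral lebesgue_measure
    (fun s : measurableTypeR R => \1_(`]a, b]%classic) s * \1_(`]c, e]%classic) s)
    (overlap a b c e).
Proof.
have E : (fun s : measurableTypeR R =>
    \1_(`]a, b]%classic) s * \1_(`]c, e]%classic) s) =
    (\1_(`]Num.max a c, Num.min b e]%classic) : R -> R).
  apply/funext => s; rewrite !indicE !mem_setE !in_itv/= -natrM mulnb.
  by rewrite gt_max le_min; congr (_%:R); case: (a < s); case: (c < s);
    case: (s <= b); case: (s <= e).
have L : lebesgue_measure (`]Num.max a c, Num.min b e]%classic : set R)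
    = (overlap a b c e)%:E.
  rewrite lebesgue_measure_itv/= lte_fin /overlap; case: ltP => H.
    by rewrite [Num.max 0 _]max_r ?subr_ge0 ?ltW// EFinB.
  by rewrite [Num.max 0 _]max_l// subr_le0.
have ml : measurable (`]Num.max a c, Num.min b e]%classic : set R) by [].
have IE : (\int[lebesgue_measure]_s
    (\1_(`]Num.max a c, Num.min b e]%classic) s : R)%:E = (overlap a b c e)%:E)%E.
  by rewrite integral_indic// setIT.
rewrite E; split; last by rewrite /Rintegral IE.
apply/integrableP; split; first by apply/measurable_EFinP; exact: measurable_indic.
rewrite (eq_integral (fun s : measurableTypeR R =>
  (\1_(`]Num.max a c, Num.min b e]%classic) s : R)%:E)) ?IE ?ltry//.
by move=> s _ /=; rewrite ger0_norm// indicE.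
Qed.

Section Isometry.
Context d (T : measurableType d) (R : realType) (P : probability T R).
Context (F : R -> set (set T)) (W : R -> T -> R).
Context (fF : filtration F) (bW : brownian_motion P F W).
Context (I : finType) (xi : I -> T -> R) (a b : I -> R).
Context (a0 : forall i, 0 <= a i) (ab : forall i, a i <= b i).
Context (bx : forall i, bounded_wrt (F (a i)) (xi i)).

Definition elementary_process (z : T * measurableTypeR R) : R :=
  \sum_i xi i z.1 * \1_(`]a i, b i]%classic) z.2.

Definition elementary_integral (w : T) : R :=
  \sum_i xi i w * increment W (a i) (b i) w.

Lemma measurable_elementary_process : measurable_fun setT elementary_process.
Proof.
apply: measurable_sum => i; apply: measurable_funM.
  apply: (measurableT_comp (f := xi i)) => //.
  by apply: measurable_wrt_fun (bx i).1; exact: filtration_measurable.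
have mi : measurable_fun setT
  (\1_(`]a i, b i]%classic : set R) : measurableTypeR R -> R).
  exact: measurable_indic.
exact: (measurableT_comp mi measurable_snd).
Qed.

Lemma measurable_elementary_integral : measurable_fun setT elementary_integral.
Proof.
apply: measurable_sum => i; apply: measurable_funM.
  by apply: measurable_wrt_fun (bx i).1; exact: filtration_measurable.
exact: measurable_increment fF bW _ _ (a0 i) (ab i).
Qed.

Lemma sqr_sum (J : finType) (f : J -> R) :
  (\sum_i f i) ^+ 2 = \sum_i \sum_j f i * f j.
Proof. by rewrite expr2 big_distrlr. Qed.

Let cov := \sum_i \sum_j
  overlap (a i) (b i) (a j) (b j) * \int[P]_w (xi i w * xi j w).

Let integral_sqr :
  has_integral P (fun w => elementary_integral w ^+ 2)
    (normal_second_moment R * cov).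
Proof.
have E : normal_second_moment R * cov = \sum_i \sum_j normal_second_moment R *
    (overlap (a i) (b i) (a j) (b j) * \int[P]_w (xi i w * xi j w)).
  by rewrite mulr_sumr; apply: eq_bigr => i _; rewrite mulr_sumr.
rewrite E.
have := @has_integral_sum _ _ _ P I _ _ (fun i => @has_integral_sum _ _ _ P I
  _ _ (fun j => mul_increments fF bW (a0 i) (ab i) (a0 j) (ab j) (bx i) (bx j))).
by apply: eq_has_integral => w; rewrite /elementary_integral sqr_sum.
Qed.

Let section_sqr w : has_integral lebesgue_measure
  (fun s => elementary_process (w, s) ^+ 2)
  (\sum_i \sum_j overlap (a i) (b i) (a j) (b j) * (xi i w * xi j w)).
Proof.
have E : \sum_i \sum_j overlap (a i) (b i) (a j) (b j) * (xi i w * xi j w) =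
   \sum_i \sum_j (xi i w * xi j w) * overlap (a i) (b i) (a j) (b j).
  by apply: eq_bigr => i _; apply: eq_bigr => j _; rewrite mulrC.
rewrite E.
have := @has_integral_sum _ _ _ lebesgue_measure I _ _
  (fun i => @has_integral_sum _ _ _ lebesgue_measure I _ _
  (fun j => has_integralZ (xi i w * xi j w)
     (has_integral_overlap (a i) (b i) (a j) (b j)))).
apply: eq_has_integral => s; rewrite /elementary_process sqr_sum.
by apply: eq_bigr => i _; apply: eq_bigr => j _; rewrite mulrACA.
Qed.

Let integral_section : has_integral P (fun w =>
  \sum_i \sum_j overlap (a i) (b i) (a j) (b j) * (xi i w * xi j w)) cov.
Proof.
apply: has_integral_sum => i; apply: has_integral_sum => j.
apply: has_integralZ.
have m0 : 0 <= Num.max (a i) (a j) by rewrite le_max a0.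
have bz : bounded_wrt (F (Num.max (a i) (a j))) (fun w => xi i w * xi j w).
  apply: (bounded_wrtM fF) => //.
    by apply: bounded_wrt_le (bx i) => //; rewrite le_max lexx.
  by apply: bounded_wrt_le (bx j) => //; rewrite le_max lexx orbT.
exact: (bounded_wrt_integrable P fF m0 bz).
Qed.

Lemma elementary_isometry :
  (\int[P]_w (elementary_integral w ^+ 2)%:E = (normal_second_moment R)%:E *
    \int[P \x lebesgue_measure]_z (elementary_process z ^+ 2)%:E)%E.
Proof.
rewrite (has_integral_EFin integral_sqr) EFinM; congr (_ * _)%E.
rewrite fubini_tonelli1; last 2 first.
- by apply/measurable_EFinP; apply: measurable_funX;
    exact: measurable_elementary_process.
- by move=> z; rewrite lee_fin sqr_ge0.
rewrite -(has_integral_EFin integral_section); apply: eq_integral => w _.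
by rewrite /fubini_F (has_integral_EFin (section_sqr w)).
Qed.

End Isometry.

Lemma indic_restrict (R : realType) (a b c e s : R) : a <= b -> c <= e ->
  \1_(`]Num.max a c, Num.max (Num.max a c) (Num.min b e)]%classic) s
  = \1_(`]a, b]%classic) s * \1_(`]c, e]%classic) s :> R.
Proof.
move=> ab ce; rewrite !indicE !mem_setE !in_itv/= -natrM mulnb.
congr (_%:R).
rewrite !gt_max !le_max le_min leNgt [s <= c]leNgt.
by case: (a < s); case: (c < s); case: (s <= b); case: (s <= e).
Qed.

Lemma increment_restrict d (T : measurableType d) (R : realType) (W : R -> T -> R)
    (a b c e : R) w : a <= b -> c <= e ->
  increment W (Num.max a c) (Num.max (Num.max a c) (Num.min b e)) w
  = (W (Num.min e b) w - W (Num.min c b) w)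
    - (W (Num.min e a) w - W (Num.min c a) w).
Proof.
move=> ab ce; rewrite /increment.
have [bc|cb] := orP (le_total b c).
  have -> : Num.min e b = b by apply/min_r; lra.
  have -> : Num.min e a = a by apply/min_r; lra.
  have -> : Num.min c b = b by apply/min_r; lra.
  have -> : Num.min c a = a by apply/min_r; lra.
  have -> : Num.max a c = c by apply/max_r; lra.
  rewrite max_l; first by ring.
  by rewrite ge_min bc.
have -> : Num.min c b = c by apply/min_l; lra.
have [ea|ae] := orP (le_total e a).
  have -> : Num.min e b = e by apply/min_l; lra.
  have -> : Num.min e a = e by apply/min_l; lra.
  have -> : Num.min c a = c by apply/min_l; lra.
  have -> : Num.max a c = a by apply/max_l; lra.
  rewrite max_l; first by ring.
  by rewrite ge_min ea orbT.
have -> : Num.min e a = a by apply/min_r; lra.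
rewrite [Num.max (Num.max a c) _]max_r; last first.
  by rewrite ge_max !le_min ab ce ae cb.
rewrite [Num.min e b]minC.
by case: (leP a c) => ac; ring.
Qed.

(** * Localization of the Ito integral *)

Section Grid.
Context (R : realType) (N : nat) (t : nat -> R).
Context (tS : forall i, t i <= t i.+1).

Lemma sum_indic_grid (s : R) :
  \sum_(i < N) \1_(`]t i, t i.+1]%classic) s = \1_(`]t 0, t N]%classic) s :> R.
Proof.
have ti i : t 0%N <= t i by elim: i => // i; move/le_trans; apply.
elim: N => [|n IHn].
  by rewrite big_ord0 indicE mem_setE in_itv/= ltNge andNb.
rewrite big_ord_recr/= IHn !indicE !mem_setE !in_itv/= -natrD; congr (_%:R).
have := ti n; have := tS n.
case: (ltP (t 0%N) s); case: (leP s (t n)); case: (leP s (t n.+1)) => //= *;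
  exfalso; lra.
Qed.

End Grid.

Section Restriction.
Context d (T : measurableType d) (R : realType).
Context (F : R -> set (set T)) (W : R -> T -> R) (fF : filtration F).
Context (J : finType) (eta : J -> T -> R) (u v : J -> R).
Context (u0 : forall j, 0 <= u j) (uv : forall j, u j <= v j).
Context (be : forall j, bounded_wrt (F (u j)) (eta j)).
Context (N : nat) (t : nat -> R) (B : nat -> set T).
Context (t0 : 0 <= t 0%N) (tS : forall i, t i <= t i.+1).
Context (FB : forall i, (i < N)%N -> F (t i) (B i)).

Definition grid_indic (z : T * measurableTypeR R) : R :=
  \sum_(i < N) \1_(B i) z.1 * \1_(`]t i, t i.+1]%classic) z.2.

(* The product of [grid_indic] with an elementary process is again elementary, with
   one term on ]max(t_i, u_j), min(t_(i+1), v_j)] (if nonempty) for each pair (i, j). *)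
Definition restrict_coef (ij : 'I_N * J) (w : T) : R :=
  \1_(B ij.1) w * eta ij.2 w.
Definition restrict_start (ij : 'I_N * J) := Num.max (t ij.1) (u ij.2).
Definition restrict_end (ij : 'I_N * J) :=
  Num.max (restrict_start ij) (Num.min (t ij.1.+1) (v ij.2)).

Definition stopped_sum (s : R) (w : T) : R :=
  \sum_j eta j w * (W (Num.min (v j) s) w - W (Num.min (u j) s) w).

Lemma grid_ge0 i : 0 <= t i.
Proof. by elim: i => // i; move/le_trans; apply. Qed.

Lemma restrict_start_ge0 ij : 0 <= restrict_start ij.
Proof. by rewrite le_max grid_ge0. Qed.

Lemma restrict_start_end ij : restrict_start ij <= restrict_end ij.
Proof. by rewrite le_max lexx. Qed.

Lemma restrict_coef_bounded ij :
  bounded_wrt (F (restrict_start ij)) (restrict_coef ij).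
Proof.
apply: (bounded_wrtM fF); first exact: restrict_start_ge0.
  apply: (bounded_wrt_le fF (grid_ge0 ij.1)); first by rewrite le_max lexx.
  by apply: (bounded_wrt_indic fF); [exact: grid_ge0|exact: FB].
by apply: (bounded_wrt_le fF (u0 ij.2)) => //; rewrite le_max lexx orbT.
Qed.

Lemma restrict_process z :
  elementary_process restrict_coef restrict_start restrict_end z
  = grid_indic z * elementary_process eta u v z.
Proof.
rewrite /elementary_process /grid_indic big_distrlr/= pair_big/=.
apply: eq_bigr => -[i j] _ /=.
by rewrite /restrict_coef /restrict_end /restrict_start/= indic_restrict// mulrACA.
Qed.

Lemma restrict_integral w : (forall i, (i < N)%N -> B i w) ->
  elementary_integral W restrict_coef restrict_start restrict_end w
  = stopped_sum (t N) w - stopped_sum (t 0%N) w.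
Proof.
move=> Bw; rewrite /elementary_integral.
transitivity (\sum_(i < N) (stopped_sum (t i.+1) w - stopped_sum (t i) w)).
  rewrite /stopped_sum.
  under [RHS]eq_bigr do rewrite -sumrB.
  rewrite pair_big/=; apply: eq_bigr => -[i j] _ /=.
  rewrite /restrict_coef /restrict_end /restrict_start/= increment_restrict//.
  by rewrite indicE mem_set ?mul1r -?mulrBr//; exact: Bw.
by rewrite -(big_mkord xpredT
  (fun i => stopped_sum (t i.+1) w - stopped_sum (t i) w)) telescope_sumr.
Qed.

Lemma grid_indic_ge0 z : 0 <= grid_indic z.
Proof. by apply: sumr_ge0 => i _; rewrite mulr_ge0// indicE. Qed.

Lemma grid_indic_le z : grid_indic z <= \1_(`]t 0%N, t N]%classic) z.2.
Proof.
rewrite -sum_indic_grid//; apply: ler_sum => i _.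
by rewrite ler_piMl// indicE// lern1 leq_b1.
Qed.

Lemma measurable_grid_indic : measurable_fun setT grid_indic.
Proof.
apply: measurable_sum => i; apply: measurable_funM.
  have mB : measurable_fun setT (\1_(B i) : T -> R).
    apply: measurable_indic.
    by apply: (filtration_measurable fF (grid_ge0 i)); exact: FB.
  exact: (measurableT_comp mB measurable_fst).
have mi : measurable_fun setT
  (\1_(`]t i, t i.+1]%classic : set R) : measurableTypeR R -> R).
  exact: measurable_indic.
exact: (measurableT_comp mi measurable_snd).
Qed.

End Restriction.

Section ItoLocalization.
Context d (T : measurableType d) (R : realType) (P : probability T R).
Context (F : R -> set (set T)) (W H M : R -> T -> R).
Context (fF : filtration F) (bW : brownian_motion P F W).
Context (itoM : ito_integral P F W H M).
Context (mH : measurable_fun setT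
  (fun z : T * measurableTypeR R => H (Num.max 0 z.2) z.1)).
Context (N : nat) (t : nat -> R) (B : nat -> set T) (D : set T) (c : R).
Context (t0 : 0 <= t 0%N) (tS : forall i, t i <= t i.+1).
Context (FB : forall i, (i < N)%N -> F (t i) (B i)).
Context (mD : measurable D) (DB : forall i, (i < N)%N -> D `<=` B i).

Let p := t 0%N.
Let q := t N.
Let leb := @lebesgue_measure R.

Let tge0 i : 0 <= t i.
Proof. exact: grid_ge0 t0 tS i. Qed.

Let pq : p <= q.
Proof. by rewrite /q; elim: N => // n; move/le_trans; apply. Qed.

Section OneApproximation.
Context (S : simple_process F).

(* The additional summand of [J] carries the constant process [- c] on ]0, q]. *)
Let J : finType := ('I_(sp_size S) + 'I_1)%type.

Let eta (j : J) : T -> R :=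
  match j with inl j => sp_coef S j | inr _ => fun=> - c end.
Let u (j : J) : R := match j with inl j => sp_time S j | inr _ => 0 end.
Let v (j : J) : R := match j with inl j => sp_time S j.+1 | inr _ => q end.

Let sp_time_pos i : 0 <= sp_time S i.
Proof. by rewrite (le_trans (sp_time_ge0 S))// sp_time_le. Qed.

Let u0 j : 0 <= u j.
Proof. by case: j => [j|j] /=; first exact: sp_time_pos. Qed.

Let uv j : u j <= v j.
Proof. by case: j => [j|_] /=; [exact: sp_time_le|exact: tge0]. Qed.

Let be j : bounded_wrt (F (u j)) (eta j).
Proof.
case: j => [j|_] /=; last exact: bounded_wrt_cst.
split; first exact: sp_coef_measurable.
by have [C SC] := sp_coef_bounded S; exists C => w; exact: SC.
Qed.

Let elem := elementary_process eta u v.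
Let G := grid_indic N t B.
Let Z := elementary_integral W (restrict_coef eta B (N := N))
  (restrict_start u t) (restrict_end u v t).

Let elemE w s : 0 < s <= q -> elem (w, s) = simple_eval S s w - c.
Proof.
move=> /andP[s0 sq]; rewrite /elem /elementary_process big_sumType/= big_ord1/=.
by rewrite indicE mem_set ?mulr1//= in_itv/= s0.
Qed.

Let stopped_sumE s w : 0 <= s <= q ->
  stopped_sum W eta u v s w = simple_integral S W s w - c * (W s w - W 0 w).
Proof.
move=> /andP[s0 sq]; rewrite /stopped_sum big_sumType/= big_ord1/=.
by rewrite (min_r sq) (min_l s0) mulNr.
Qed.

Let mS : measurable_fun setT
  (fun z : T * measurableTypeR R => simple_eval S z.2 z.1).
Proof.
exact: (@measurable_elementary_process _ _ _ _ fF 'I_(sp_size S)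
  (fun j => sp_coef S j) (fun j => sp_time S j) (fun j => sp_time S j.+1)
  (fun j => sp_time_pos j) (fun j => be (inl j))).
Qed.

Let mI s : 0 <= s -> measurable_fun setT (simple_integral S W s).
Proof.
move=> s0; apply: measurable_sum => j; apply: measurable_funM.
  exact: measurable_wrt_fun (filtration_measurable fF (u0 (inl j)))
    (be (inl j)).1.
apply: (measurable_increment fF bW); first by rewrite le_min s0 sp_time_pos.
by rewrite le_min !ge_min lexx orbT sp_time_le.
Qed.

Let err s w := simple_integral S W s w - M s w.
Let Herr (z : T * measurableTypeR R) : R :=
  \1_(`[0, q]%classic) z.2 * (simple_eval S z.2 z.1 - H (Num.max 0 z.2) z.1) ^+ 2.

Let ZE w : D w -> M q w - M p w - c * (W q w - W p w)
  = Z w + (err p w - err q w).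
Proof.
move=> Dw; rewrite /Z (restrict_integral W eta uv tS); last by move=> i /DB; apply.
have hp : 0 <= p <= q by rewrite pq andbT; exact: tge0.
have hq : 0 <= q <= q by rewrite lexx andbT; exact: tge0.
rewrite (stopped_sumE w hp) (stopped_sumE w hq).
by rewrite /err -/p -/q; ring.
Qed.

Let mZ : measurable_fun setT Z.
Proof.
apply: (measurable_elementary_integral fF bW).
- exact: (restrict_start_ge0 _ t0 tS).
- exact: restrict_start_end.
- exact: (restrict_coef_bounded fF u0 be t0 tS FB).
Qed.

Let merr s : 0 <= s -> measurable_fun setT (err s).
Proof.
move=> s0; apply: measurable_funB; first exact: mI.
by case: itoM => _ + _; apply.
Qed.

Let mHerr : measurable_fun setT Herr.
Proof.
apply: measurable_funM.
  have mi : measurable_fun setT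
    (\1_(`[0, q]%classic : set R) : measurableTypeR R -> R).
    exact: measurable_indic.
  exact: (measurableT_comp mi measurable_snd).
by apply: measurable_funX; apply: measurable_funB; [exact: mS|exact: mH].
Qed.

Let mtarget : measurable_fun setT
  (fun z => G z * (H (Num.max 0 z.2) z.1 - c) ^+ 2).
Proof.
apply: measurable_funM; first exact: (measurable_grid_indic fF t0 tS FB).
by apply: measurable_funX; exact: measurable_funB.
Qed.

Let process_bound z : (G z * elem z) ^+ 2 <=
  2 * Herr z + 2 * (G z * (H (Num.max 0 z.2) z.1 - c) ^+ 2).
Proof.
have G0 : 0 <= G z by exact: grid_indic_ge0.
have G1 : G z <= \1_(`]p, q]%classic) z.2 by exact: grid_indic_le.
have H0 : 0 <= Herr z by rewrite mulr_ge0 ?sqr_ge0// indicE.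
have [zpq|zpq] := boolP (z.2 \in `]p, q]); last first.
  have -> : G z = 0.
    apply/eqP; rewrite eq_le G0 andbT (le_trans G1)//.
    by rewrite indicE mem_setE (negbTE zpq).
  by rewrite !mul0r expr0n/= mulr0 addr0 mulr_ge0.
move: zpq; rewrite in_itv/= => /andP[pz zq].
have z0 : 0 < z.2 by rewrite (le_lt_trans _ pz)// tge0.
have G1' : G z <= 1 by rewrite (le_trans G1)// indicE lern1 leq_b1.
rewrite [in X in X <= _](surjective_pairing z) elemE -?surjective_pairing;
  last by rewrite z0 zq.
rewrite /Herr indicE mem_set ?mul1r; last by rewrite /= in_itv/= ltW.
set g := G z in G0 G1' *; set x := simple_eval _ _ _; set y := H _ _.
rewrite exprMn; apply: (@le_trans _ _ (g * (x - c) ^+ 2)).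
  by rewrite ler_wpM2r ?sqr_ge0// expr2 ler_piMl.
apply: (@le_trans _ _ (g * (2 * (x - y) ^+ 2 + 2 * (y - c) ^+ 2))).
  rewrite ler_wpM2l// -subr_ge0.
  have -> : 2 * (x - y) ^+ 2 + 2 * (y - c) ^+ 2 - (x - c) ^+ 2
    = ((x - y) - (y - c)) ^+ 2 by ring.
  exact: sqr_ge0.
rewrite mulrDr; apply: lerD; last by rewrite mulrCA.
by rewrite ler_piMl// mulr_ge0// sqr_ge0.
Qed.

Lemma simple_localization_bound :
  (\int[P]_(w in D) ((M q w - M p w - c * (W q w - W p w)) ^+ 2)%:E <=
    (4 * normal_second_moment R)%:E *
      \int[P \x leb]_z (grid_indic N t B z *
        (H (Num.max 0 z.2) z.1 - c) ^+ 2)%:E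
    + ((4 * normal_second_moment R)%:E *
       (\int[P]_w \int[leb]_(s in `[0%R, q])
         ((simple_eval S s w - H s w) ^+ 2)%:E)
     + (4%:E * (\int[P]_w ((simple_integral S W p w - M p w) ^+ 2)%:E)
     + 4%:E * (\int[P]_w ((simple_integral S W q w - M q w) ^+ 2)%:E))))%E.
Proof.
have v0 := normal_second_moment_ge0 R.
have p0 := tge0 0%N; have q0 := tge0 N.
have HerrE : (\int[P]_w \int[leb]_(s in `[0%R, q])
     ((simple_eval S s w - H s w) ^+ 2)%:E = \int[P \x leb]_z (Herr z)%:E)%E.
  rewrite fubini_tonelli1; last 2 first.
  - by apply/measurable_EFinP; exact: mHerr.
  - by move=> z; rewrite lee_fin mulr_ge0 ?sqr_ge0// indicE.
  apply: eq_integral => w _; rewrite /fubini_F [LHS]integral_mkcond.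
  apply: eq_integral => s _; rewrite patchE /Herr/= indicE.
  case: ifPn => [|_]; last by rewrite mul0r.
  rewrite inE/= in_itv/= => /andP[s0 _].
  by rewrite mul1r max_r.
have iso : (\int[P]_w (Z w ^+ 2)%:E = (normal_second_moment R)%:E *
    \int[P \x leb]_z ((G z * elem z) ^+ 2)%:E)%E.
  rewrite (elementary_isometry fF bW).
  - congr (_ * _)%E; apply: eq_integral => z _.
    by rewrite (restrict_process eta uv N B tS).
  - exact: (restrict_start_ge0 _ t0 tS).
  - exact: restrict_start_end.
  - exact: (restrict_coef_bounded fF u0 be t0 tS FB).
have step1 : (\int[P]_(w in D) ((M q w - M p w - c * (W q w - W p w)) ^+ 2)%:E
    <= \int[P]_w (2%:E * (Z w ^+ 2)%:E +
      (4%:E * (err p w ^+ 2)%:E + 4%:E * (err q w ^+ 2)%:E)))%E.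
  rewrite integral_mkcond; apply: ge0_le_integral => //.
  - by move=> w _; rewrite patchE; case: ifPn => // _; rewrite lee_fin sqr_ge0.
  - apply/(measurable_restrictT _ mD); apply/measurable_funTS/measurable_EFinP.
    have mM s : 0 <= s -> measurable_fun setT (M s).
      by case: itoM => _ + _; apply.
    apply: measurable_funX; apply: measurable_funB.
      by apply: measurable_funB; exact: mM.
    apply: measurable_funM => //.
    exact: (measurable_increment fF bW p0 pq).
  - apply/measurable_EFinP; apply: measurable_funD.
      by apply: measurable_funM => //; apply: measurable_funX; exact: mZ.
    by apply: measurable_funD; apply: measurable_funM => //;
      apply: measurable_funX; exact: merr.
  - move=> w _; rewrite patchE; case: ifPn => [|_].
      rewrite inE => Dw; rewrite ZE// -!EFinM -!EFinD lee_fin -subr_ge0.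
      set x := Z w; set y := err p w; set z := err q w.
      have -> : 2 * x ^+ 2 + (4 * y ^+ 2 + 4 * z ^+ 2) - (x + (y - z)) ^+ 2
        = (x - y + z) ^+ 2 + 2 * (y + z) ^+ 2 by ring.
      by rewrite addr_ge0 ?sqr_ge0// mulr_ge0// sqr_ge0.
    by rewrite -!EFinM -!EFinD lee_fin; rewrite !addr_ge0// mulr_ge0// sqr_ge0.
apply: (le_trans step1).
have sq0 (f : T -> R) (k : R) : 0 <= k ->
    forall w, setT w -> (0 <= k%:E * (f w ^+ 2)%:E)%E.
  by move=> k0 w _; rewrite -EFinM lee_fin mulr_ge0 ?sqr_ge0.
have msq (f : T -> R) : measurable_fun setT f ->
    measurable_fun setT (fun w => (f w ^+ 2)%:E).
  by move=> mf; apply/measurable_EFinP; exact: measurable_funX.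
have mksq (f : T -> R) (k : R) : measurable_fun setT f ->
    measurable_fun setT (fun w => k%:E * (f w ^+ 2)%:E)%E.
  by move=> mf; apply: emeasurable_funM => //; exact: msq.
rewrite ge0_integralD//; [|exact: sq0|exact: (mksq _ _ mZ)| |]; last 2 first.
- by move=> w _; apply: adde_ge0; exact: sq0.
- by apply: emeasurable_funD; apply: mksq; exact: merr.
rewrite [X in (_ + X)%E]ge0_integralD//; [|exact: sq0|exact/mksq/merr|
  exact: sq0|exact/mksq/merr].
have Zl (f : T -> R) (k : R) : 0 <= k -> measurable_fun setT f ->
    (\int[P]_w (k%:E * (f w ^+ 2)%:E) = k%:E * \int[P]_w (f w ^+ 2)%:E)%E.
  move=> k0 mf; apply: ge0_integralZl => //; first exact: msq.
  by move=> w _; rewrite lee_fin sqr_ge0.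
rewrite (Zl _ _ _ mZ)// (Zl _ _ _ (merr p0))// (Zl _ _ _ (merr q0))//.
rewrite [leRHS]addeA; apply: leeD => //; rewrite iso HerrE.
have step2 : (\int[P \x leb]_z ((G z * elem z) ^+ 2)%:E <=
    2%:E * \int[P \x leb]_z (Herr z)%:E +
    2%:E * \int[P \x leb]_z (G z * (H (Num.max 0 z.2) z.1 - c) ^+ 2)%:E)%E.
  have h0 z : 0 <= Herr z by rewrite mulr_ge0 ?sqr_ge0// indicE.
  have g0 z : 0 <= G z * (H (Num.max 0 z.2) z.1 - c) ^+ 2.
    by rewrite mulr_ge0 ?sqr_ge0//; exact: grid_indic_ge0.
  have mh : measurable_fun setT (fun z => (Herr z)%:E).
    by apply/measurable_EFinP; exact: mHerr.
  have mg : measurable_fun setT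
      (fun z => (G z * (H (Num.max 0 z.2) z.1 - c) ^+ 2)%:E).
    by apply/measurable_EFinP; exact: mtarget.
  have m2 (f : T * measurableTypeR R -> R) :
      measurable_fun setT (fun z => (f z)%:E) ->
      measurable_fun setT (fun z => 2%:E * (f z)%:E)%E.
    by move=> mf; exact: emeasurable_funM.
  have p2 (f : T * measurableTypeR R -> R) : (forall z, 0 <= f z) ->
      forall z, setT z -> (0 <= 2%:E * (f z)%:E)%E.
    by move=> f0 z _; rewrite -EFinM lee_fin mulr_ge0.
  have Z2 (f : T * measurableTypeR R -> R) : (forall z, 0 <= f z) ->
      measurable_fun setT (fun z => (f z)%:E) ->
      (\int[P \x leb]_z (2%:E * (f z)%:E)
       = 2%:E * \int[P \x leb]_z (f z)%:E)%E.
    move=> f0 mf; apply: ge0_integralZl => //.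
    by move=> z _; rewrite lee_fin.
  rewrite -(Z2 _ h0 mh) -(Z2 _ g0 mg).
  rewrite -(ge0_integralD _ measurableT (p2 _ h0) (m2 _ mh) (p2 _ g0) (m2 _ mg)).
  apply: ge0_le_integral => //.
  - by move=> z _; rewrite lee_fin sqr_ge0.
  - apply/measurable_EFinP; apply: measurable_funX; apply: measurable_funM.
      exact: (measurable_grid_indic fF t0 tS FB).
    exact: (measurable_elementary_process fF _ u0 be).
  - by apply: emeasurable_funD; exact: emeasurable_funM.
  - by move=> z _; rewrite -!EFinM -EFinD lee_fin process_bound.
apply: (le_trans (lee_wpmul2l _ (lee_wpmul2l _ step2))) => //.
rewrite muleA -EFinM ge0_muleDr; last 2 first.
- by apply: mule_ge0 => //; apply: integral_ge0 => z _;
    rewrite lee_fin mulr_ge0 ?sqr_ge0// indicE.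
- by apply: mule_ge0 => //; apply: integral_ge0 => z _;
    rewrite lee_fin mulr_ge0 ?sqr_ge0//; exact: grid_indic_ge0.
rewrite !muleA -!EFinM addeC.
rewrite (_ : 2 * normal_second_moment R * 2 = 4 * normal_second_moment R)//.
by ring.
Qed.

End OneApproximation.

Lemma ito_localization_bound :
  (\int[P]_(w in D) ((M q w - M p w - c * (W q w - W p w)) ^+ 2)%:E <=
    (4 * normal_second_moment R)%:E *
      \int[P \x leb]_z (grid_indic N t B z *
        (H (Num.max 0 z.2) z.1 - c) ^+ 2)%:E)%E.
Proof.
case: itoM => _ _ [S approx].
have p0 := tge0 0%N; have q0 := tge0 N.
have [_ cp] := approx p p0; have [cH cq] := approx q q0.
set A := (X in (_ <= X)%E).
apply: (@cvge_ge _ \oo _ _ (fun n => A + ((4 * normal_second_moment R)%:E *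
       (\int[P]_w \int[leb]_(s in `[0%R, q])
         ((simple_eval (S n) s w - H s w) ^+ 2)%:E)
     + (4%:E * (\int[P]_w ((simple_integral (S n) W p w - M p w) ^+ 2)%:E)
     + 4%:E * (\int[P]_w ((simple_integral (S n) W q w - M q w) ^+ 2)%:E))))%E).
  by apply: nearW => n; exact: simple_localization_bound.
rewrite -[X in _ --> X]adde0; apply: cvgeD; first by rewrite fin_num_adde_defl.
  exact: cvg_cst.
have Z0 (k : R) (f : nat -> \bar R) : (f @ \oo --> 0)%E ->
    (k%:E * f n @[n --> \oo] --> 0)%E.
  by move=> f0; rewrite -(mule0 k%:E); exact: cvgeZl.
rewrite -[X in _ --> X]adde0; apply: cvgeD => //; first exact: Z0.
by rewrite -[X in _ --> X]adde0; apply: cvgeD => //; exact: Z0.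
Qed.

End ItoLocalization.

(** * Paths of a solution *)

Section DeterministicPath.
Context (R : realType) (x : R -> R).
Context (cx : {within `[0, +oo[, continuous x}).

Lemma path_gt_near (z c : R) : 0 <= z -> c < x z ->
  exists2 e : R, 0 < e & forall r, 0 <= r -> `|z - r| < e -> c < x r.
Proof.
move=> z0 xc.
have xz : c < x (Num.max 0 z) by rewrite max_r.
have /nbhs_ballP[e e0 ez] : nbhs z [set r | c < x (Num.max 0 r)].
  exact: cvgr_gt _ (continuous_max0 cx (x := z)) _ xz.
by exists e => // r r0 zr; have := ez r zr; rewrite /= max_r.
Qed.

Lemma path_lt_near (z c : R) : 0 <= z -> x z < c ->
  exists2 e : R, 0 < e & forall r, 0 <= r -> `|z - r| < e -> x r < c.
Proof.
move=> z0 xc.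
have xz : x (Num.max 0 z) < c by rewrite max_r.
have /nbhs_ballP[e e0 ez] : nbhs z [set r | x (Num.max 0 r) < c].
  exact: cvgr_lt _ (continuous_max0 cx (x := z)) _ xz.
by exists e => // r r0 zr; have := ez r zr; rewrite /= max_r.
Qed.

Lemma integrable_path (phi : R -> R) (C t : R) : measurable_fun setT phi ->
  (forall y, `|phi y| <= C) ->
  lebesgue_measure.-integrable `[0, t] (EFin \o (fun s => phi (x s))).
Proof.
move=> mphi phiC; apply: measurable_bounded_integrable => //.
- have : (lebesgue_measure (`[0%R, t]%classic : set R) < +oo)%E.
    by rewrite lebesgue_measure_itv/=; case: ifP => // _; exact: ltry.
  by [].
- move=> mI B mB.
  have -> : `[0, t]%classic `&` (fun s => phi (x s)) @^-1` B =
      `[0, t]%classic `&` (fun s => phi (x (Num.max 0 s))) @^-1` B.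
    by apply/seteqP; split=> s [] /[dup] s0t /=; rewrite in_itv/= =>
      /andP[s0 _]; rewrite max_r.
  apply: measurableI => //; rewrite -[X in measurable X]setTI.
  apply: (measurableT_comp mphi) => //.
  exact: continuous_measurable_fun (continuous_max0 cx).
- exists C; split; first exact: num_real.
  by move=> K CK s _; exact: le_trans (phiC _) (ltW CK).
Qed.

Context (l : R) (l0 : 0 < l).
Context (rising : forall p q : rat, 0 <= ratr p :> R -> ratr p <= ratr q :> R ->
  (forall s, ratr p <= s <= ratr q -> x s < 0) ->
  x (ratr q) - x (ratr p) = l * (ratr q - ratr p)).

Lemma path_stays_nonneg u t : 0 <= u -> u <= t -> 0 <= x u -> 0 <= x t.
Proof.
move=> u0 ut xu; rewrite leNgt; apply/negP => xt.
pose E := [set r | u <= r <= t /\ 0 <= x r].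
have Eu : E u by split=> //; rewrite lexx.
have ubE : ubound E t by move=> r [/andP[]].
have hsE : has_sup E by split; [exists u|exists t].
pose z := sup E.
have uz : u <= z by apply: ub_le_sup => //; exists t.
have zt : z <= t by apply: ge_sup => //; exists u.
have z0 : 0 <= z := le_trans u0 uz.
have xz : 0 <= x z.
  rewrite leNgt; apply/negP => xz.
  have [e e0 ez] := path_lt_near z0 xz.
  have [r [/andP[ur rt] xr] zr] := sup_adherent e0 hsE.
  have rz : r <= z by apply: ub_le_sup; [exists t|split=> //; rewrite ur].
  have := ez r (le_trans u0 ur).
  by rewrite ger0_norm ?subr_ge0// ltrBlDl -ltrBlDr => /(_ zr); rewrite ltNge xr.
have zt' : z < t.
  by rewrite lt_neqAle zt andbT; apply/eqP => zE; move: xt; rewrite -zE ltNge xz.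
have neg s : z < s -> s <= t -> x s < 0.
  move=> zs st; rewrite ltNge; apply/negP => xs.
  have : s <= z.
    by apply: ub_le_sup; [exists t|split=> //; rewrite st (le_trans uz (ltW zs))].
  by rewrite leNgt zs.
have [q] := rat_in_itvoo zt'; rewrite in_itv/= => /andP[zq qt].
have xq := neg _ zq (ltW qt).
have [e e0 ez] := path_gt_near z0 (lt_le_trans xq xz).
have zm : z < Num.min (ratr q) (z + e) by rewrite lt_min zq ltrDl.
have [p] := rat_in_itvoo zm; rewrite in_itv/= lt_min => /and3P[zp pq pe].
have p0 : 0 <= ratr p :> R := le_trans z0 (ltW zp).
have xqp : x (ratr q) < x (ratr p).
  by apply: ez => //; rewrite distrC gtr0_norm ?subr_gt0// ltrBlDl.
have : x (ratr q) - x (ratr p) = l * (ratr q - ratr p).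
  apply: rising => // [|s /andP[ps sq]]; first exact: ltW.
  by apply: neg; [exact: lt_le_trans ps|exact: le_trans (ltW qt)].
have : 0 < l * (ratr q - ratr p) by rewrite mulr_gt0// subr_gt0.
move=> /[swap] <-; rewrite subr_gt0; apply/negP; by rewrite -leNgt ltW.
Qed.

Lemma path_reaches_nonneg (k : nat) : - (l * k%:R) <= x 0 -> 0 <= x k%:R.
Proof.
move=> xk; rewrite leNgt; apply/negP => xk0.
have neg s : 0 <= s <= k%:R -> x s < 0.
  move=> /andP[s0 sk]; rewrite ltNge; apply/negP => xs.
  by move: xk0; rewrite ltNge (path_stays_nonneg s0 sk xs).
have r0 : ratr 0 = 0 :> R by rewrite rmorph0.
have rk : ratr k%:R = k%:R :> R by rewrite ratr_nat.
have := @rising 0 k%:R; rewrite r0 rk => /(_ (lexx _) (ler0n _ _) neg) H.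
have : x k%:R = l * k%:R + x 0 by rewrite -(subrK (x 0) (x k%:R)) H subr0.
move=> xE; move: xk0; rewrite xE ltNge => /negP; apply.
by rewrite -lerBlDl sub0r.
Qed.

End DeterministicPath.

Lemma ae_eq0_on d (T : measurableType d) (R : realType) (P : probability T R)
    (D : set T) (Y : T -> R) : measurable D -> measurable_fun setT Y ->
  (\int[P]_(w in D) (Y w ^+ 2)%:E <= 0)%E ->
  {ae P, forall w, D w -> Y w = 0}.
Proof.
move=> mD mY le0.
have m2 : measurable_fun D (fun w => (Y w ^+ 2)%:E).
  by apply/measurable_EFinP; apply: measurable_funTS; exact: measurable_funX.
have /(ae_eq_integral_abs P mD m2) : (\int[P]_(w in D) `|(Y w ^+ 2)%:E| = 0)%E.
  apply/eqP; rewrite eq_le integral_ge0// andbT.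
  apply: le_trans le0; rewrite le_eqVlt; apply/orP; left; apply/eqP.
  by apply: eq_integral => w _; rewrite gee0_abs// lee_fin sqr_ge0.
apply: filterS => w H Dw; have /= := H Dw.
by move=> [] /eqP; rewrite sqrf_eq0 => /eqP.
Qed.

Lemma exists_pos_probability d (T : measurableType d) (R : realType)
    (P : probability T R) (A : set T) (E : nat -> set T) :
  measurable A -> (forall n, measurable (E n)) -> A `<=` \bigcup_n E n ->
  (0 < P A)%E -> exists n, (0 < P (A `&` E n))%E.
Proof.
move=> mA mE AE PA; apply: contrapT => /forallNP H.
have : P.-negligible (\bigcup_n (A `&` E n)).
  apply: negligible_bigcup => n; apply/negligibleP; first exact: measurableI.
  by apply/eqP; rewrite eq_le measure_ge0 andbT leNgt; exact/negP/H.
rewrite -setI_bigcupr setIidl// => /negligibleP => /(_ mA) P0.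
by move: PA; rewrite P0 ltxx.
Qed.

Section UniformGrid.
Context (R : realType) (p q : R) (n : nat).

Definition uniform_grid (i : nat) : R := p + i%:R * ((q - p) / n.+1%:R).

Lemma uniform_grid0 : uniform_grid 0%N = p.
Proof. by rewrite /uniform_grid mul0r addr0. Qed.

Lemma uniform_gridN : uniform_grid n.+1 = q.
Proof.
by rewrite /uniform_grid mulrCA divff ?mulr1 ?pnatr_eq0// addrC subrK.
Qed.

Lemma uniform_gridS i : uniform_grid i.+1 = uniform_grid i + (q - p) / n.+1%:R.
Proof. by rewrite /uniform_grid -natr1 mulrDl mul1r addrA. Qed.

Lemma uniform_grid_le i : p <= q -> uniform_grid i <= uniform_grid i.+1.
Proof.
by move=> pq; rewrite uniform_gridS lerDl divr_ge0// subr_ge0.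
Qed.

End UniformGrid.

Lemma grid_indic_eventually0 d (T : measurableType d) (R : realType)
    (X : R -> T -> R) (p q : R) w s :
  continuous_process X -> 0 <= p -> p <= q -> 0 < X (Num.max 0 s) w ->
  \forall n \near \oo, grid_indic n.+1 (uniform_grid p q n)
    (fun i => X (uniform_grid p q n i) @^-1` `]-oo, 0[%classic) (w, s) = 0.
Proof.
move=> cX p0 pq Xs.
have m0 : 0 <= Num.max 0 s by rewrite le_max lexx.
have [e e0 ez] := path_gt_near (cX w) m0 Xs.
have d0 : 0 < e / (q - p + 1) by rewrite divr_gt0// ltr_wpDl ?subr_ge0.
near=> n.
have step : (q - p) / n.+1%:R < e.
  have H : n.+1%:R^-1 < e / (q - p + 1).
    by near: n; exact: (near_infty_natSinv_lt (PosNum d0)).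
  apply: (@le_lt_trans _ _ ((q - p + 1) * n.+1%:R^-1)).
    by rewrite ler_wpM2r// lerDl.
  by rewrite -ltr_pdivlMl ?ltr_wpDl ?subr_ge0// mulrC.
rewrite /grid_indic big1// => i _ /=.
set t := uniform_grid p q n.
have tS j : t j <= t j.+1 by exact: uniform_grid_le.
have t0 : 0 <= t 0%N by rewrite /t uniform_grid0.
have ti := grid_ge0 t0 tS i.
have [|si] := boolP (s \in `]t i, t i.+1]); last first.
  by rewrite [X in _ * X]indicE mem_setE (negbTE si) mulr0.
rewrite in_itv/= => /andP[ts st].
rewrite indicE memNset ?mul0r//= in_itv/= ltNge => /negP; apply; apply: ltW.
have s0 : 0 <= s := le_trans ti (ltW ts).
apply: ez => //; rewrite max_r// ger0_norm ?subr_ge0 ?ltW//.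
by apply: le_lt_trans step; rewrite lerBlDl; move: st; rewrite /t uniform_gridS.
Unshelve. all: by end_near. Qed.

Section SwitchedNoise.
Context d (T : measurableType d) (R : realType) (P : probability T R).
Context (F : R -> set (set T)) (X W M : R -> T -> R).
Context (fF : filtration F) (bW : brownian_motion P F W).
Context (cX : continuous_process X) (aX : adapted F X).

Let pos : set R := [set y | 0 < y].

Context (itoM : ito_integral P F W (fun t w => \1_pos (X t w)) M).

Let mpos : measurable pos.
Proof.
rewrite (_ : pos = `]0, +oo[%classic); first by [].
by apply/seteqP; split=> y /=; rewrite in_itv/= andbT.
Qed.

Lemma measurable_adapted t : 0 <= t -> measurable_fun setT (X t).
Proof.
by move=> t0; apply: measurable_wrt_fun (aX t0); exact: filtration_measurable.
Qed.

Lemma measurable_ito_integral t : 0 <= t -> measurable_fun setT (M t).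
Proof. by case: itoM => _ + _; apply. Qed.

Let mH : measurable_fun setT
  (fun z : T * measurableTypeR R => \1_pos (X (Num.max 0 z.2) z.1) : R).
Proof.
have mi : measurable_fun setT (\1_pos : R -> R).
  by apply: measurable_indic; exact: mpos.
apply: (measurableT_comp mi).
exact: measurable_continuous_process measurable_adapted cX.
Qed.

(* The noise is switched off below zero: the localization bound with [c = 0] on
   the grid events [X (t_i) < 0] tends to zero as the mesh does. *)
Lemma ito_constant_below (p q : R) : 0 <= p -> p <= q ->
  {ae P, forall w, (forall s, p <= s <= q -> X s w < 0) -> M q w - M p w = 0}.
Proof.
move=> p0 pq; have q0 := le_trans p0 pq.
pose t n := uniform_grid p q n.
pose B n i := X (t n i) @^-1` `]-oo, 0[%classic.
pose D := \bigcap_n \bigcap_(i in `I_n.+1) B n i.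
have tS n i : t n i <= t n i.+1 by exact: uniform_grid_le.
have t0 n : 0 <= t n 0%N by rewrite /t uniform_grid0.
have FB n i : (i < n.+1)%N -> F (t n i) (B n i).
  by move=> _; apply: (aX (grid_ge0 (t0 n) (tS n) i)).
have mB n i : measurable (B n i).
  apply: (filtration_measurable fF (grid_ge0 (t0 n) (tS n) i)).
  exact: (aX (grid_ge0 (t0 n) (tS n) i)).
have mD : measurable D.
  by apply: bigcapT_measurable => n; apply: bigcap_measurableType => i _.
have DB n i : (i < n.+1)%N -> D `<=` B n i by move=> ni w Dw; exact: Dw.
have mM := measurable_ito_integral.
have mMM : measurable_fun setT (fun w => M q w - M p w).
  by apply: measurable_funB; exact: mM.
have bound n := @ito_localization_bound _ _ _ _ _ _ _ _ fF bW itoM mH n.+1 (t n)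
  (B n) D 0 (t0 n) (tS n) (FB n) mD (DB n).
pose G n (z : T * measurableTypeR R) : R := grid_indic n.+1 (t n) (B n) z *
  (\1_pos (X (Num.max 0 z.2) z.1) - 0) ^+ 2.
have mG n : measurable_fun setT (fun z => (G n z)%:E).
  apply/measurable_EFinP; apply: measurable_funM.
    exact: (measurable_grid_indic fF (t0 n) (tS n) (FB n)).
  by apply: measurable_funX; apply: measurable_funB; first exact: mH.
pose g (z : T * measurableTypeR R) : \bar R :=
  (\1_([set: T] `*` (`]p, q]%classic : set (measurableTypeR R))) z)%:E.
have mI : measurable ([set: T] `*` (`]p, q]%classic : set (measurableTypeR R))).
  exact: measurableX.
have ig : (P \x lebesgue_measure)%E.-integrable setT g.
  apply/integrableP; split; first by apply/measurable_EFinP/measurable_indic.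
  rewrite (eq_integral g); last first.
    by move=> z _; rewrite gee0_abs// lee_fin indicE.
  rewrite integral_indic// setIT.
  have L : (lebesgue_measure (`]p, q]%classic : set R) < +oo)%E.
    by rewrite lebesgue_measure_itv/=; case: ifP => // _; exact: ltry.
  have E : ((P \x lebesgue_measure) ([set: T] `*`
      (`]p, q]%classic : set (measurableTypeR R))) =
      P [set: T] * lebesgue_measure (`]p, q]%classic : set R))%E.
    exact: product_measure1E.
  move: L; rewrite -[X in (X < _)%E]mul1e -(probability_setT P).
  by move=> L; apply: le_lt_trans L; rewrite -E.
have Gg n z : (`|(G n z)%:E| <= g z)%E.
  have G0 : 0 <= grid_indic n.+1 (t n) (B n) z by exact: grid_indic_ge0.
  rewrite gee0_abs ?lee_fin ?mulr_ge0 ?sqr_ge0//.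
  apply: (@le_trans _ _ (grid_indic n.+1 (t n) (B n) z)).
    by rewrite ler_piMr// subr0 indicE; case: (_ \in _); rewrite ?expr1n ?expr0n.
  apply: (le_trans (grid_indic_le _ _ (tS n) z)).
  rewrite /t uniform_grid0 uniform_gridN !indicE.
  by rewrite (_ : (z \in setT `*` _) = (z.2 \in `]p, q]%classic))// in_setX in_setT.
have G0 z : (G n z)%:E @[n --> \oo] --> 0%E.
  apply: cvg_near_cst; rewrite /G subr0 indicE.
  have [|_] := boolP (X (Num.max 0 z.2) z.1 \in pos); last first.
    by apply: nearW => n; rewrite expr0n mulr0.
  rewrite inE /pos/= => Xz; case: z Xz => w s /= Xz.
  have := grid_indic_eventually0 cX p0 pq Xz.
  by apply: filterS => n; rewrite /B /t => ->; rewrite mul0r.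
have [_ _] := dominated_convergence measurableT mG (measurable_cst 0%E)
  (aeW _ (fun z _ => G0 z)) ig (aeW _ (fun z n _ => Gg n z)).
rewrite integral0 => cvgG.
have le0 : (\int[P]_(w in D) ((M q w - M p w) ^+ 2)%:E <= 0)%E.
  apply: (@cvge_ge _ \oo _ _ (fun n => (4 * normal_second_moment R)%:E *
    \int[P \x lebesgue_measure]_z (G n z)%:E)%E).
    apply: nearW => n; have := bound n.
    rewrite {1 2 3 4}/t uniform_grid0 uniform_gridN.
    by under eq_integral do rewrite mul0r subr0.
  by rewrite -[X in _ --> X](mule0 (4 * normal_second_moment R)%:E); exact: cvgeZl.
have := ae_eq0_on mD mMM le0; apply: filterS => w H Xneg.
apply: H => n _ i /= ni; rewrite /B/= in_itv/=; apply: Xneg.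
have hom : {homo (t n) : i j / (i <= j)%N >-> i <= j}.
  by apply: homo_leq => //; exact: le_trans.
have h0 : t n 0%N <= t n i by exact: hom.
have hN : t n i <= t n n.+1 by apply: hom; exact: ltnW.
by move: h0 hN; rewrite /t uniform_grid0 uniform_gridN => -> ->.
Qed.

Lemma ito_increment_above (p q : R) (A : set T) : 0 <= p -> p <= q -> F p A ->
  no_time_at_zero P X ->
  {ae P, forall w, A w -> forall s, p <= s <= q -> 0 <= X s w} ->
  {ae P, forall w, A w -> M q w - M p w - (W q w - W p w) = 0}.
Proof.
move=> p0 pq FA noT Xpos; have q0 := le_trans p0 pq.
pose t (i : nat) := if i is 0%N then p else q.
have tS i : t i <= t i.+1 by case: i.
have FB i : (i < 1)%N -> F (t i) A by case: i.
have mA : measurable A := filtration_measurable fF p0 FA.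
have DB i : (i < 1)%N -> A `<=` A by move=> _ w.
have := @ito_localization_bound _ _ _ _ _ _ _ _ fF bW itoM mH 1 t
  (fun=> A) A 1 p0 tS FB mA DB.
pose G (z : T * measurableTypeR R) : R := grid_indic 1 t (fun=> A) z *
  (\1_pos (X (Num.max 0 z.2) z.1) - 1) ^+ 2.
have mG : measurable_fun setT (fun z => (G z)%:E).
  apply/measurable_EFinP; apply: measurable_funM.
    exact: (measurable_grid_indic fF p0 tS FB).
  by apply: measurable_funX; apply: measurable_funB; first exact: mH.
have G0 z : (0 <= (G z)%:E)%E.
  by rewrite lee_fin mulr_ge0 ?sqr_ge0// grid_indic_ge0.
have -> : (\int[P \x lebesgue_measure]_z (G z)%:E = 0)%E.
  rewrite fubini_tonelli1//.
  rewrite (ae_eq_integral (cst 0%E)) ?integral0//; last first.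
    have := noT q q0; move: Xpos; apply: filterS2 => w Xw noTw _ /=.
    have iz : lebesgue_measure.-integrable `[0, q]
        (EFin \o (fun s => \1_[set 0 : R] (X s w) : R)).
      apply: (@integrable_path R (fun s => X s w) (@cX w) (\1_[set 0 : R]) 1 q);
        first exact: measurable_indic.
      by move=> y; rewrite indicE ger0_norm// lern1 leq_b1.
    have z0 : (\int[lebesgue_measure]_(s in `[0%R, q])
        (\1_[set 0 : R] (X s w) : R)%:E = 0)%E.
      rewrite -[LHS]fineK; last exact: integrable_fin_num iz.
      by congr (_%:E).
    apply/eqP; rewrite eq_le; apply/andP; split; last exact: integral_ge0.
    rewrite -z0 [leRHS]integral_mkcond; apply: ge0_le_integral => //.
    - exact: (measurable_fun_pair2 w mG).
    - apply/(measurable_restrictT _ _).1; first by [].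
      by case/integrableP: iz.
    - move=> s _; rewrite patchE /G /grid_indic big_ord1/=.
      have [s0q|s0q] := boolP (s \in `[0, q]%classic); last first.
        rewrite [X in _ * X * _]indicE memNset ?mulr0 ?mul0r//= in_itv/=.
        move=> /andP[ps sq]; move: s0q; rewrite notin_setE/= in_itv/=; apply.
        by rewrite sq andbT (le_trans p0)// ltW.
      have [Aw|Aw] := pselect (A w); last first.
        by rewrite indicE memNset// !mul0r lee_fin indicE.
      have [|spq] := boolP (s \in `]p, q]); last first.
        by rewrite [X in _ * X * _]indicE mem_setE (negbTE spq) mulr0 mul0r
          lee_fin indicE.
      rewrite in_itv/= => /andP[ps sq].
      have s0 : 0 <= s by rewrite (le_trans p0)// ltW.
      rewrite max_r// lee_fin.
      have Xs : 0 <= X s w by apply: Xw => //; rewrite sq ltW.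
      move: Xs; rewrite le_eqVlt => /predU1P[Xs|Xs].
        rewrite -Xs [X in _ <= X]indicE mem_set// [X in (X - 1)]indicE.
        rewrite memNset /pos/= ?ltxx// sub0r sqrrN expr1n mulr1.
        by rewrite !indicE -natrM lern1 mulnb leq_b1.
      rewrite [X in (X - 1)]indicE mem_set// subrr expr0n mulr0.
      by rewrite indicE.
  exact: measurable_fun_fubini_tonelli_F.
rewrite mule0 => le0.
have mY : measurable_fun setT (fun w => M q w - M p w - (W q w - W p w)).
  apply: measurable_funB; last exact: (measurable_increment fF bW p0 pq).
  by apply: measurable_funB; exact: measurable_ito_integral.
apply: (ae_eq0_on mA mY); move: le0.
by under eq_integral do rewrite mul1r.
Qed.

End SwitchedNoise.

Section NoWeakSolution.
Context (R : realType) (kappa lambda : R) (lambda0 : 0 < lambda).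

Definition two_sided_drift (x : R) : R :=
  kappa * \1_[set y : R | 0 < y] x + lambda * \1_[set y : R | y <= 0] x.

Lemma measurable_two_sided_drift : measurable_fun setT two_sided_drift.
Proof.
have m1 : measurable [set y : R | 0 < y].
  rewrite (_ : mkset _ = `]0, +oo[%classic); first by [].
  by apply/seteqP; split=> y /=; rewrite in_itv/= andbT.
have m2 : measurable [set y : R | y <= 0].
  rewrite (_ : mkset _ = `]-oo, 0]%classic); first by [].
  by apply/seteqP; split=> y /=; rewrite in_itv.
by apply: measurable_funD; apply: measurable_funM => //; exact: measurable_indic.
Qed.

Lemma two_sided_drift_neg x : x < 0 -> two_sided_drift x = lambda.
Proof.
move=> x0; rewrite /two_sided_drift !indicE memNset/=; last first.
  by apply/negP; rewrite -leNgt ltW.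
by rewrite mem_set ?mulr0 ?mulr1 ?add0r//= ltW.
Qed.

Lemma two_sided_drift_le x : `|two_sided_drift x| <= `|kappa| + `|lambda|.
Proof.
apply: (le_trans (ler_normD _ _)); rewrite !normrM !indicE.
by apply: lerD; rewrite ler_piMr// ger0_norm// lern1 leq_b1.
Qed.

Let C := `|kappa| + `|lambda|.

Section Solution.
Context d (T : measurableType d) (P : probability T R).
Context (F : R -> set (set T)) (X W M : R -> T -> R).
Context (fF : filtration F) (bW : brownian_motion P F W)
  (cX : continuous_process X) (aX : adapted F X)
  (itoM : ito_integral P F W (fun t w => \1_[set y : R | 0 < y] (X t w)) M)
  (solX : {ae P, forall w, forall t : R, 0 <= t -> X t w = X 0 w
     + \int[lebesgue_measure]_(s in `[0, t]) two_sided_drift (X s w) + M t w})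
  (noT : no_time_at_zero P X).

Let increment_eq w (p q : R) :
  (forall t : R, 0 <= t -> X t w = X 0 w
     + \int[lebesgue_measure]_(s in `[0, t]) two_sided_drift (X s w) + M t w) ->
  0 <= p -> p <= q -> X q w - X p w =
  \int[lebesgue_measure]_(s in `]p, q]) two_sided_drift (X s w)
    + (M q w - M p w).
Proof.
move=> sol p0 pq; rewrite (sol p p0) (sol q (le_trans p0 pq)).
have iq : lebesgue_measure.-integrable `[0, q]
    (EFin \o (fun s => two_sided_drift (X s w))).
  exact: (integrable_path (@cX w) q measurable_two_sided_drift
    two_sided_drift_le).
rewrite -(Rintegral_itvB (a := BLeft 0) (b := BRight q) (x := p) iq); first by ring.
- by rewrite bnd_simp.
- by rewrite bnd_simp.
Qed.

Let integrable_along w (phi : R -> R) (p q : R) : 0 <= p ->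
  measurable_fun setT phi -> (forall y, `|phi y| <= C) ->
  lebesgue_measure.-integrable `]p, q] (EFin \o (fun s => phi (X s w))).
Proof.
move=> p0 mphi phiC.
apply: (@integrableS _ _ _ lebesgue_measure `[0, q]%classic) => //.
  move=> s /=; rewrite !in_itv/= => /andP[ps ->].
  by rewrite andbT (le_trans p0)// ltW.
exact: (integrable_path (@cX w) q mphi phiC).
Qed.

Let Rintegral_cst_itv (k p q : R) : p <= q ->
  \int[lebesgue_measure]_(s in `]p, q]) (k : R) = k * (q - p).
Proof.
move=> pq; rewrite Rintegral_cst//; congr (_ * _).
have E : lebesgue_measure (`]p, q]%classic : set R) = (q - p)%:E.
  rewrite lebesgue_measure_itv/= lte_fin; case: ltP => // qp.
  have -> : q = p by apply/eqP; rewrite eq_le pq qp.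
  by rewrite subrr.
by rewrite -[q - p]/(fine (q - p)%:E) -E.
Qed.

Let constant_below : {ae P, forall w, forall p q : rat,
  0 <= ratr p :> R -> ratr p <= ratr q :> R ->
  (forall s, ratr p <= s <= ratr q -> X s w < 0) ->
  M (ratr q) w - M (ratr p) w = 0}.
Proof.
pose Q n w := if unpickle n is Some (p, q) then
  0 <= ratr p :> R -> ratr p <= ratr q :> R ->
  (forall s, ratr p <= s <= ratr q -> X s w < 0) ->
  M (ratr q) w - M (ratr p) w = 0 else True.
have : {ae P, forall w, forall n, Q n w}.
  apply: ae_foralln => n; rewrite /Q.
  case: unpickle => [[p q]|]; last exact: aeW.
  have [p0|p0] := boolP (0 <= ratr p :> R); last by apply: aeW.
  have [pq|pq] := boolP (ratr p <= ratr q :> R); last by apply: aeW.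
  have := ito_constant_below fF bW cX aX itoM p0 pq.
  by apply: filterS => w H _ _; exact: H.
by apply: filterS => w H p q; have := H (pickle (p, q)); rewrite /Q pickleK.
Qed.

Let nonneg_after : {ae P, forall w, forall (k : nat) (t : R),
  - (lambda * k%:R) <= X 0 w -> k%:R <= t -> 0 <= X t w}.
Proof.
move: solX constant_below; apply: filterS2 => w sol cst k t X0 kt.
have rising (p q : rat) : 0 <= ratr p :> R -> ratr p <= ratr q :> R ->
    (forall s, ratr p <= s <= ratr q -> X s w < 0) ->
    X (ratr q) w - X (ratr p) w = lambda * (ratr q - ratr p).
  move=> p0 pq neg; rewrite (increment_eq sol p0 pq) cst// addr0.
  rewrite -Rintegral_cst_itv//; apply: eq_Rintegral => s.
  rewrite inE/= in_itv/= => /andP[ps sq]; apply: two_sided_drift_neg.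
  by apply: neg; rewrite sq ltW.
have Xk := path_reaches_nonneg (@cX w) lambda0 rising X0.
exact: (path_stays_nonneg (@cX w) lambda0 rising (ler0n _ k) kt Xk).
Qed.

Lemma no_solution : False.
Proof.
have archi (y : R) : exists k : nat, y <= k%:R.
  exists (Num.bound `|y|); rewrite (le_trans (ler_norm y))// ltW//.
  exact: archi_boundP.
pose E0 (k : nat) := X 0 @^-1` `[- (lambda * k%:R), +oo[%classic.
have FE0 k : F 0 (E0 k) by apply: (aX (lexx 0)).
have [k Pk] : exists k, (0 < P ([set: T] `&` E0 k))%E.
  apply: exists_pos_probability => //.
  - by move=> k; exact: (filtration_measurable fF (lexx 0)).
  - move=> w _; have [k Hk] := archi (- X 0 w / lambda).
    exists k => //; rewrite /E0 /= in_itv/= andbT lerNl mulrC.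
    by rewrite -ler_pdivrMr.
  - by rewrite probability_setT lte01.
rewrite setTI in Pk.
pose p : R := k%:R; pose q : R := k.+1%:R.
have p0 : 0 <= p by exact: ler0n.
have pq : p < q by rewrite ltr_nat.
have qp : q - p = 1 by rewrite /q /p -natr1; ring.
have q0 : 0 <= q := le_trans p0 (ltW pq).
have FpE : F p (E0 k) by exact: (filtration_sub fF (lexx 0) p0).
have mE : measurable (E0 k) := filtration_measurable fF p0 FpE.
pose L (n : nat) := X p @^-1` `]-oo, n%:R]%classic.
have FpL n : F p (L n) by apply: (aX p0).
have [n Pn] : exists n, (0 < P (E0 k `&` L n))%E.
  apply: exists_pos_probability => //.
  - by move=> n; exact: (filtration_measurable fF p0).
  - move=> w _; have [n Hn] := archi (X p w).
    by exists n => //; rewrite /L /= in_itv.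
have FB : F p (E0 k `&` L n).
  have sF := filtration_sigma fF p0.
  have : @measurable _ (g_sigma_algebraType (F p)) (E0 k `&` L n).
    by apply: measurableI; exact: sub_sigma_algebra.
  by rewrite /measurable/= sigma_algebra_id.
pose Y := increment W p q.
pose bad := `]-oo, - (n%:R + C) - 1]%classic : set R.
have mb : measurable bad by exact: measurable_itv.
have pos : (0 < P ((E0 k `&` L n) `&` Y @^-1` bad))%E.
  rewrite (increment_independent bW p0 pq FB mb).
  rewrite mule_gt0// (increment_law bW p0 pq mb).
  by apply: normal_prob_lt_gt0; rewrite sqrtr_gt0 subr_gt0.
have Xpos : {ae P, forall w, E0 k w -> forall s, p <= s <= q -> 0 <= X s w}.
  move: nonneg_after; apply: filterS => w H; rewrite /E0/= in_itv/= andbT.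
  by move=> Xk s /andP[ps _]; exact: (H k s Xk ps).
have MW := ito_increment_above fF bW cX aX itoM p0 (ltW pq) FpE noT Xpos.
have null : {ae P, forall w, ~ ((E0 k `&` L n) `&` Y @^-1` bad) w}.
  move: solX MW nonneg_after; apply: filterS3 => w sol MWw nonneg [[Ew Lw] Yw].
  have Xk : - (lambda * k%:R) <= X 0 w.
    by move: Ew; rewrite /E0/= in_itv/= andbT.
  have Xq : 0 <= X q w by apply: (nonneg k) => //; exact: ltW.
  have Xp : X p w <= n%:R by move: Lw; rewrite /L/= in_itv.
  have Yb : W q w - W p w <= - (n%:R + C) - 1.
    by move: Yw; rewrite /Y /bad/= in_itv.
  have C0 : 0 <= C by rewrite addr_ge0.
  have drift : \int[lebesgue_measure]_(s in `]p, q]) two_sided_drift (X s w) <= C.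
    rewrite -[leRHS]mulr1 -qp -Rintegral_cst_itv ?(ltW pq)//.
    apply: le_Rintegral => //.
    - exact: integrable_along measurable_two_sided_drift two_sided_drift_le.
    - by apply: (@integrable_along w (fun=> C)) => // y; rewrite ger0_norm.
    - move=> s _; exact: le_trans (ler_norm _) (two_sided_drift_le _).
  have := increment_eq sol p0 (ltW pq); have := MWw Ew.
  by move: drift; set I := Rintegral _ _ _; lra.
move: pos; have mbad : measurable ((E0 k `&` L n) `&` Y @^-1` bad).
  apply: measurableI; first by apply: (filtration_measurable fF p0).
  rewrite -[X in measurable X]setTI.
  exact: (measurable_increment fF bW p0 (ltW pq)).
have : P.-negligible ((E0 k `&` L n) `&` Y @^-1` bad).
  by apply: negligibleS null => w /= Hw; apply.
by move=> /negligibleP => /(_ mbad) ->; rewrite ltxx.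
Qed.

End Solution.

End NoWeakSolution.

Theorem theorem4 (R : realType) :
  (forall kappa lambda : R, 0 < lambda ->
     ~ exists (d : measure_display) (T : measurableType d)
         (P : probability T R) (F : R -> set (set T)) (X W : R -> T -> R),
         weak_solution
           (fun x => kappa * \1_[set y : R | 0 < y] x
                     + lambda * \1_[set y : R | y <= 0] x)
           (fun x => \1_[set y : R | 0 < y] x) P F X W
         /\ no_time_at_zero P X)
  /\
  (forall lambda : R, 0 < lambda ->
     ~ exists (d : measure_display) (T : measurableType d)
         (P : probability T R) (F : R -> set (set T)) (X W : R -> T -> R),
         weak_solution (fun _ => lambda)
           (fun x => \1_[set y : R | 0 < y] x) P F X W
         /\ no_time_at_zero P X).
Proof.
have none kappa lambda : 0 < lambda ->
    ~ exists (d : measure_display) (T : measurableType d)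
         (P : probability T R) (F : R -> set (set T)) (X W : R -> T -> R),
         weak_solution (two_sided_drift kappa lambda)
           (fun x => \1_[set y : R | 0 < y] x) P F X W /\ no_time_at_zero P X.
  move=> lambda0 [d [T [P [F [X [W [[fF bW cX aX [M itoM solX]] noT]]]]]]].
  exact: (no_solution lambda0 fF bW cX aX itoM solX noT).
split=> [kappa|] lambda lambda0; first exact: none.
rewrite (_ : (fun=> lambda) = two_sided_drift lambda lambda); first exact: none.
apply/funext => x; rewrite /two_sided_drift !indicE.
have [x0|x0] := ltP 0 x.
  rewrite mem_set// memNset ?mulr0 ?mulr1 ?addr0//=.
  by apply/negP; rewrite -ltNge.
rewrite memNset ?mem_set ?mulr0 ?mulr1 ?add0r//=.
by apply/negP; rewrite -leNgt.
Qed.
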